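(* Let $\mathcal{T}$ be a weakly approximable triangulated category with a bounded compact generator. The following statements are true. (1) Up to equivalence of $t$-structures, there exists a unique bounded $t$-structure on $\mathcal{T}^b$. (2) Suppose that $\mathcal{T}$ has finite strong finitistic dimension. Then any full triangulated subcategory $\mathcal{U}$ of $\mathcal{T}$ with $\mathcal{T}^{sb}\subseteq \mathcal{U}\subsetneq \mathcal{T}^b$ admits no bounded $t$-structure. Thus $\mathcal{T}^{sb}$ admits a bounded $t$-structure if and only if $\mathcal{T}^{sb}=\mathcal{T}^{b}$.
   Context: Full subcategories are assumed closed under isomorphism. Let $\mathcal{T}$ be a triangulated category with small coproducts and shift functor $[1]$. Extensions: for full subcategories $\mathcal{X},\mathcal{Y}$, $\mathcal{X}\ast\mathcal{Y}$ consists of the objects $Z$ admitting a triangle $X\to Z\to Y\to X[1]$ with $X\in\mathcal{X}$, $Y\in\mathcal{Y}$; $\mathcal{X}$ is closed under extensions if $\mathcal{X}\ast\mathcal{X}\subseteq\mathcal{X}$. For $G\in\mathcal{T}$ and $a\le b$ in $\mathbb{Z}\cup\{\pm\infty\}$, $\overline{\langle G\rangle}^{[a,b]}$ is the smallest full subcategory of $\mathcal{T}$ containing $G[-i]$ for all integers $i$ with $a\le i\le b$ and closed under direct summands, coproducts and extensions (with an open bracket at an infinite endpoint). An object $G$ is compact if $\mathrm{Hom}_{\mathcal{T}}(G,-)$ preserves coproducts. A compact generator is a compact object $G$ with $\mathcal{T}=\overline{\langle G\rangle}^{(-\infty,+\infty)}$ (equivalently, $\mathrm{Hom}_{\mathcal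 T}(G[i],X)=0$ for all $i\in\mathbb{Z}$ implies $X=0$). It is bounded if $\mathrm{Hom}_{\mathcal{T}}(G,G[i])=0$ for $i\ll0$. A $t$-structure on a triangulated category $\mathcal{C}$ is a pair of full subcategories $(\mathcal{C}^{\le0},\mathcal{C}^{\ge1})$ with $\mathcal{C}^{\le0}[1]\subseteq\mathcal{C}^{\le0}$, $\mathcal{C}^{\ge1}\subseteq\mathcal{C}^{\ge1}[1]$, $\mathrm{Hom}_{\mathcal{C}}(\mathcal{C}^{\le0},\mathcal{C}^{\ge1})=0$, and such that each $X\in\mathcal{C}$ fits in a triangle $X^{\le0}\to X\to X^{\ge1}\to X^{\le0}[1]$ with $X^{\le0}\in\mathcal{C}^{\le0}$, $X^{\ge1}\in\mathcal{C}^{\ge1}$. Put $\mathcal{C}^{\le n}=\mathcal{C}^{\le0}[-n]$, $\mathcal{C}^{\ge n+1}=\mathcal{C}^{\ge1}[-n]$. It is bounded if $\mathcal{C}=\bigcup_{m\geq 1}\mathcal{C}^{\le m}=\bigcup_{m\geq 1}\mathcal{C}^{\ge -m}$. Two $t$-structures $(\mathcal{C}_1^{\le0},\mathcal{C}_1^{\ge1})$, $(\mathcal{C}_2^{\le0},\mathcal{C}_2^{\ge1})$ are equivalent if $\mathcal{C}_1^{\le -n}\subseteq\mathcal{C}_2^{\le0}\subseteq\mathcal{C}_1^{\le n}$ for some $n\in\mathbb{N}$. $\mathcal{T}$ is weakly approximable if it has a compact generator $G$, a $t$-structure $(\mathcal{T}^{\le0},\mathcal{T}^{\ge1})$ and an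 integer $A>0$ such that (i) $G[A]\in\mathcal{T}^{\le0}$ and $\mathrm{Hom}_{\mathcal{T}}(G[-A],\mathcal{T}^{\le0})=0$; (ii) each $F\in\mathcal{T}^{\le0}$ admits a triangle $E\to F\to D\to E[1]$ with $E\in\overline{\langle G\rangle}^{[-A,A]}$ and $D\in\mathcal{T}^{\le-1}$. For a compact generator $G$, there is a $t$-structure on $\mathcal{T}$ given by $\mathcal{T}_G^{\le0}=\overline{\langle G\rangle}^{(-\infty,0]}$ and $\mathcal{T}_G^{\ge1}=\{X\mid \mathrm{Hom}_{\mathcal T}(G[i],X)=0\ \forall i\ge0\}$. Set $\mathcal{T}^-=\bigcup_n\mathcal{T}_G^{\le n}$, $\mathcal{T}^+=\bigcup_n\mathcal{T}_G^{\ge -n}$, $\mathcal{T}^b=\mathcal{T}^-\cap\mathcal{T}^+$ (bounded objects), and $\mathcal{T}^{sb}=\bigcup_{n\in\mathbb{N}}\overline{\langle G\rangle}^{[-n,n]}$ (strongly bounded objects); these do not depend on the choice of $G$, and $\mathcal{T}^{sb}\subseteq\mathcal{T}^b$ when $G$ is bounded. $\mathcal{T}$ has finite strong finitistic dimension if there is an integer $m$ such that $\{X\in\mathcal{T}^{sb}\mid \mathrm{Hom}_{\mathcal{T}}(X,G[i])=0\ \forall i\le-1\}\subseteq\bigcup_{n\le m}\overline{\langle G\rangle}^{[n,m]}$, where $G$ is a compact generator (this is independent of the choice of $G$). *)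

(* Defs.v *)
From HB Require Import structures.
From mathcomp Require Import all_boot all_order all_algebra.

Set Implicit Arguments.
Unset Strict Implicit.
Unset Printing Implicit Defensive.

Import Order.TTheory GRing.Theory Num.Theory.
Local Open Scope ring_scope.

(* The universe of small sets.  [hom_small] only serves to put the Hom groups
   in it, so that a category with small coproducts has coproducts indexed by
   its Hom sets; the collection of objects may be larger. *)
Definition small := Type.
Definition hom_small (V : zmodType) : small := V.

Reserved Notation "g \oc f" (at level 40, left associativity).

Record preadditive := Preadditive {
  obj :> Type;
  hom : obj -> obj -> zmodType;
  idm : forall X, hom X X;
  comp : forall X Y Z, hom Y Z -> hom X Y -> hom X Z;
  comp_idl : forall X Y (f : hom X Y), comp (idm Y) f = f;
  comp_idr : forall X Y (f : hom X Y), comp f (idm X) = f;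
  compA : forall X Y Z W (h : hom Z W) (g : hom Y Z) (f : hom X Y),
    comp h (comp g f) = comp (comp h g) f;
  compDl : forall X Y Z (g g' : hom Y Z) (f : hom X Y),
    comp (g + g') f = comp g f + comp g' f;
  compDr : forall X Y Z (g : hom Y Z) (f f' : hom X Y),
    comp g (f + f') = comp g f + comp g f'
}.

Arguments hom {p} X Y.
Arguments idm {p} X.
Arguments comp {p X Y Z} g f.
Notation "g \oc f" := (comp g f).

Section Preadditive.
Variable C : preadditive.
Implicit Types X Y Z : C.

Definition is_iso X Y (f : hom X Y) : Prop :=
  exists g : hom Y X, g \oc f = idm X /\ f \oc g = idm Y.

Definition isomorphic X Y : Prop := exists f : hom X Y, is_iso f.

Definition is_zero X : Prop := idm X = 0.

Definition is_biproduct X Y Z : Prop :=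
  exists (i1 : hom X Z) (i2 : hom Y Z) (p1 : hom Z X) (p2 : hom Z Y),
    [/\ p1 \oc i1 = idm X, p2 \oc i2 = idm Y, p2 \oc i1 = 0, p1 \oc i2 = 0
      & i1 \oc p1 + i2 \oc p2 = idm Z].

Definition direct_summand X Z : Prop := exists Y, is_biproduct X Y Z.

Definition is_coproduct (I : small) (F : I -> C) Z
    (inj : forall i, hom (F i) Z) : Prop :=
  forall W (g : forall i, hom (F i) W),
    exists! u : hom Z W, forall i, u \oc inj i = g i.

Definition has_small_coproducts : Prop :=
  forall (I : small) (F : I -> C),
    exists (Z : C) (inj : forall i, hom (F i) Z), is_coproduct inj.

(* Hom(G, -) sends coproducts of C to coproducts of abelian groups. *)
Definition compact (G : C) : Prop :=
  forall (I : small) (F : I -> C) (Z : C) (inj : forall i, hom (F i) Z),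
    is_coproduct inj ->
    forall (A : zmodType) (phi : forall i, {additive hom G (F i) -> A}),
      exists psi : {additive hom G Z -> A},
        (forall i f, psi (inj i \oc f) = phi i f) /\
        (forall psi' : {additive hom G Z -> A},
          (forall i f, psi' (inj i \oc f) = phi i f) -> psi' =1 psi).

Record additive_endofunctor := AdditiveEndofunctor {
  fobj :> C -> C;
  fmap : forall X Y, {additive hom X Y -> hom (fobj X) (fobj Y)};
  fmap_id : forall X, fmap X X (idm X) = idm (fobj X);
  fmap_comp : forall X Y Z (g : hom Y Z) (f : hom X Y),
    fmap X Z (g \oc f) = fmap Y Z g \oc fmap X Y f
}.

Definition iso_closed (P : C -> Prop) : Prop :=
  forall X Y, isomorphic X Y -> P X -> P Y.

End Preadditive.

Arguments fmap {C} F {X Y} : rename.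

(* The shift is an auto-equivalence with a chosen quasi-inverse [unshift];
   it is not assumed to be invertible on the nose. *)
Record triangulated := Triangulated {
  tcat :> preadditive;
  zero_ex : exists Z : tcat, is_zero Z;
  biproduct_ex : forall X Y : tcat, exists Z : tcat, is_biproduct X Y Z;

  shift : additive_endofunctor tcat;
  unshift : additive_endofunctor tcat;
  shift_unit : forall X : tcat, hom X (shift (unshift X));
  shift_unit_iso : forall X, is_iso (shift_unit X);
  shift_unit_nat : forall (X Y : tcat) (f : hom X Y),
    fmap shift (fmap unshift f) \oc shift_unit X = shift_unit Y \oc f;
  shift_counit : forall X : tcat, hom (unshift (shift X)) X;
  shift_counit_iso : forall X, is_iso (shift_counit X);
  shift_counit_nat : forall (X Y : tcat) (f : hom X Y),
    f \oc shift_counit X = shift_counit Y \oc fmap unshift (fmap shift f);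

  (* [triangle f g h] : X -f-> Y -g-> Z -h-> X[1] is distinguished *)
  triangle : forall X Y Z : tcat,
    hom X Y -> hom Y Z -> hom Z (shift X) -> Prop;
  TR1_iso : forall (X Y Z X' Y' Z' : tcat)
      (f : hom X Y) (g : hom Y Z) (h : hom Z (shift X))
      (f' : hom X' Y') (g' : hom Y' Z') (h' : hom Z' (shift X'))
      (a : hom X X') (b : hom Y Y') (c : hom Z Z'),
    is_iso a -> is_iso b -> is_iso c ->
    b \oc f = f' \oc a -> c \oc g = g' \oc b ->
    fmap shift a \oc h = h' \oc c ->
    triangle f g h -> triangle f' g' h';
  TR1_id : forall X Z : tcat, is_zero Z ->
    triangle (idm X) (0 : hom X Z) (0 : hom Z (shift X));
  TR1_cone : forall (X Y : tcat) (f : hom X Y),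
    exists (Z : tcat) (g : hom Y Z) (h : hom Z (shift X)), triangle f g h;
  TR2 : forall (X Y Z : tcat)
      (f : hom X Y) (g : hom Y Z) (h : hom Z (shift X)),
    triangle f g h <-> triangle g h (- fmap shift f);
  TR3 : forall (X Y Z X' Y' Z' : tcat)
      (f : hom X Y) (g : hom Y Z) (h : hom Z (shift X))
      (f' : hom X' Y') (g' : hom Y' Z') (h' : hom Z' (shift X'))
      (a : hom X X') (b : hom Y Y'),
    triangle f g h -> triangle f' g' h' -> b \oc f = f' \oc a ->
    exists c : hom Z Z', c \oc g = g' \oc b /\ fmap shift a \oc h = h' \oc c;
  TR4 : forall (X Y Z X' Y' Z' : tcat) (f : hom X Y) (g : hom Y Z)
      (u1 : hom Y Z') (v1 : hom Z' (shift X))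
      (u2 : hom Z X') (v2 : hom X' (shift Y))
      (u3 : hom Z Y') (v3 : hom Y' (shift X)),
    triangle f u1 v1 -> triangle g u2 v2 -> triangle (g \oc f) u3 v3 ->
    exists (a : hom Z' Y') (b : hom Y' X'),
      triangle a b (fmap shift u1 \oc v2) /\
      [/\ a \oc u1 = u3 \oc g, v3 \oc a = v1, b \oc u3 = u2
        & v2 \oc b = fmap shift f \oc v3]
}.

Section Triangulated.
Variable T : triangulated.
Implicit Types X Y Z G : T.

(* X[n] *)
Definition sh X (n : int) : T :=
  match n with
  | Posz k => iter k (shift T) X
  | Negz k => iter k.+1 (unshift T) X
  end.

(* P[n], closed under isomorphism *)
Definition shift_sub (P : T -> Prop) (n : int) (X : T) : Prop :=
  exists Y, P Y /\ isomorphic X (sh Y n).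

Definition subcat_le (P Q : T -> Prop) : Prop := forall X, P X -> Q X.
Definition subcat_eq (P Q : T -> Prop) : Prop := forall X, P X <-> Q X.

Inductive generated G (J : interval int) : T -> Prop :=
| gen_base (i : int) : i \in J -> generated G J (sh G (- i))
| gen_iso X Y : isomorphic X Y -> generated G J X -> generated G J Y
| gen_summand X Z : direct_summand X Z -> generated G J Z -> generated G J X
| gen_coproduct (I : small) (F : I -> T) Z (inj : forall i, hom (F i) Z) :
    is_coproduct inj -> (forall i, generated G J (F i)) -> generated G J Z
| gen_extension X Z Y (f : hom X Z) (g : hom Z Y) (h : hom Y (shift T X)) :
    triangle f g h -> generated G J X -> generated G J Y -> generated G J Z.

Definition compact_generator G : Prop :=
  compact G /\ forall X, generated G `]-oo, +oo[ X.

Definition bounded_object G : Prop :=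
  exists N : int, forall i : int, i <= N -> forall f : hom G (sh G i), f = 0.

Record full_triangulated_subcategory (U : T -> Prop) : Prop := {
  fts_iso : iso_closed U;
  fts_zero : forall Z, is_zero Z -> U Z;
  fts_shift : forall X, U X -> U (sh X 1);
  fts_unshift : forall X, U X -> U (sh X (-1));
  fts_cone : forall X Y Z (f : hom X Y) (g : hom Y Z) (h : hom Z (shift T X)),
    triangle f g h -> U X -> U Y -> U Z
}.

(* C stands for a full triangulated subcategory: its distinguished triangles
   are those of T with vertices in C. *)
Record t_structure (C : T -> Prop) := TStructure {
  tle0 : T -> Prop;
  tge1 : T -> Prop;
  tle0_iso : iso_closed tle0;
  tge1_iso : iso_closed tge1;
  tle0_sub : subcat_le tle0 C;
  tge1_sub : subcat_le tge1 C;
  tle0_shift : subcat_le (shift_sub tle0 1) tle0;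
  tge1_shift : subcat_le tge1 (shift_sub tge1 1);
  t_orth : forall X Y, tle0 X -> tge1 Y -> forall f : hom X Y, f = 0;
  t_trunc : forall X, C X ->
    exists (A B : T) (f : hom A X) (g : hom X B) (h : hom B (shift T A)),
      [/\ triangle f g h, tle0 A & tge1 B]
}.

(* C^{<= n} = C^{<= 0}[-n] and C^{>= n} = C^{>= 1}[1 - n] *)
Definition le_part (P : T -> Prop) (n : int) : T -> Prop := shift_sub P (- n).
Definition ge_part (Q : T -> Prop) (n : int) : T -> Prop := shift_sub Q (1 - n).

Definition t_le C (t : t_structure C) : int -> T -> Prop := le_part (tle0 t).
Definition t_ge C (t : t_structure C) : int -> T -> Prop := ge_part (tge1 t).

Definition t_bounded C (t : t_structure C) : Prop :=
  subcat_eq C (fun X => exists m : nat, (1 <= m)%N /\ t_le t m%:Z X) /\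
  subcat_eq C (fun X => exists m : nat, (1 <= m)%N /\ t_ge t (- m%:Z) X).

Definition t_equivalent C (t1 t2 : t_structure C) : Prop :=
  exists n : nat,
    subcat_le (t_le t1 (- n%:Z)) (tle0 t2) /\
    subcat_le (tle0 t2) (t_le t1 n%:Z).

Definition admits_bounded_t_structure (C : T -> Prop) : Prop :=
  exists t : t_structure C, t_bounded t.

Definition weakly_approximable : Prop :=
  exists (G : T) (t : t_structure (fun _ : T => True)) (A : int),
    [/\ compact_generator G,
        0 < A,
        tle0 t (sh G A),
        (forall F, tle0 t F -> forall f : hom (sh G (- A)) F, f = 0)
      & forall F, tle0 t F ->
          exists (E D : T) (f : hom E F) (g : hom F D) (h : hom D (shift T E)),
            [/\ triangle f g h, generated G `[- A, A] E & t_le t (-1) D]].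

Definition gen_le0 G : T -> Prop := generated G `]-oo, 0].
Definition gen_ge1 G (X : T) : Prop :=
  forall i : int, 0 <= i -> forall f : hom (sh G i) X, f = 0.

Definition Tminus G (X : T) : Prop := exists n : int, le_part (gen_le0 G) n X.
Definition Tplus G (X : T) : Prop :=
  exists n : int, ge_part (gen_ge1 G) (- n) X.
Definition Tb G (X : T) : Prop := Tminus G X /\ Tplus G X.
Definition Tsb G (X : T) : Prop :=
  exists n : nat, generated G `[- n%:Z, n%:Z] X.

Definition finite_strong_finitistic_dimension : Prop :=
  exists G, compact_generator G /\
  exists m : int, forall X,
    Tsb G X ->
    (forall i : int, i <= -1 -> forall f : hom X (sh G i), f = 0) ->
    exists n : int, n <= m /\ generated G `[n, m] X.

End Triangulated.

Arguments weakly_approximable : clear implicits.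
Arguments finite_strong_finitistic_dimension : clear implicits.
Arguments has_small_coproducts : clear implicits.

(* Main.v *)
(** The Brown-style telescope with homotopy colimit of stages built from shifts
    of [G] gives both the truncations of the t-structure generated by [G] and the
    fact that every compact object lies in some [<G>^[-n,n]]; hence [Tb] and [Tsb]
    do not depend on the generator.

    (1) A bounded t-structure [t] on [Tb] satisfies [T^{<=-p} /\ Tb <= t^{<=0}]
    because [G] is in [t^{<=p}].  Conversely the heart of the standard
    t-structure is closed under coproducts, so one [M] works for all its objects
    to be in [t^{>=-M}]; filtering by standard cohomology, all bounded objects of
    [T^{>=0}] are in [t^{>=-M}], that is, [t^{<=0} <= T^{<=M}].

    (2) For [t] on [U] weak approximability gives [E -> X -> D] with [E] strongly
    bounded and [D] as negative as desired.  For [X] in [t^{<=0}], [E] is also in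
    [t^{<=0}], so [Hom(E, G[i]) = 0] for [i << 0] and the finitistic dimension
    bounds [E], hence [X], uniformly above: [t^{<=0} <= T^{<=N}].  For [X] in
    [Tb], orthogonality then forces [D[-1] -> E] to be a [t]-truncation of [E],
    so [D[-1]], and with it [X], lies in [U]. *)

From HB Require Import structures.
From mathcomp Require Import all_boot all_order all_algebra.
From mathcomp Require Import boolp.
From mathcomp Require Import zify.
(* After mathcomp, whose vector library also defines [hom]. *)
Require Import Defs.

Set Implicit Arguments.
Unset Strict Implicit.
Unset Printing Implicit Defensive.

Import Order.TTheory GRing.Theory Num.Theory.
Local Open Scope ring_scope.

(** * Coproducts and finite sums *)

Lemma dep_choice (I : Type) (F : I -> Type) (P : forall i, F i -> Prop) :
  (forall i, exists x, P i x) -> exists f : forall i, F i, forall i, P i (f i).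
Proof.
by move=> h; exists (fun i => projT1 (cid (h i))) => i; case: cid.
Qed.

Section PreadditiveTheory.
Variable C : preadditive.
Implicit Types X Y Z K : C.

Lemma comp0l X Y Z (f : hom X Y) : (0 : hom Y Z) \oc f = 0.
Proof. by apply: (addrI (0 \oc f)); rewrite -compDl !addr0. Qed.

Lemma comp0r X Y Z (g : hom Y Z) : g \oc (0 : hom X Y) = 0.
Proof. by apply: (addrI (g \oc 0)); rewrite -compDr !addr0. Qed.

Lemma compNl X Y Z (g : hom Y Z) (f : hom X Y) : (- g) \oc f = - (g \oc f).
Proof. by apply: (addrI (g \oc f)); rewrite -compDl !subrr comp0l. Qed.

Lemma compNr X Y Z (g : hom Y Z) (f : hom X Y) : g \oc (- f) = - (g \oc f).
Proof. by apply: (addrI (g \oc f)); rewrite -compDr !subrr comp0r. Qed.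

Lemma compBl X Y Z (g g' : hom Y Z) (f : hom X Y) :
  (g - g') \oc f = g \oc f - g' \oc f.
Proof. by rewrite compDl compNl. Qed.

Lemma compBr X Y Z (g : hom Y Z) (f f' : hom X Y) :
  g \oc (f - f') = g \oc f - g \oc f'.
Proof. by rewrite compDr compNr. Qed.

Lemma is_iso_id X : is_iso (idm X).
Proof. by exists (idm X); rewrite comp_idl. Qed.

Lemma is_iso_comp X Y Z (g : hom Y Z) (f : hom X Y) :
  is_iso g -> is_iso f -> is_iso (g \oc f).
Proof.
move=> [g' [g'g gg']] [f' [f'f ff']]; exists (f' \oc g').
by rewrite -!compA (compA g') g'g comp_idl f'f (compA f) ff' comp_idl gg'.
Qed.

Lemma isomorphic_refl X : isomorphic X X.
Proof. by exists (idm X); exact: is_iso_id. Qed.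

Lemma isomorphic_sym X Y : isomorphic X Y -> isomorphic Y X.
Proof. by move=> [f [g [gf fg]]]; exists g, f. Qed.

Lemma isomorphic_trans Y X Z :
  isomorphic X Y -> isomorphic Y Z -> isomorphic X Z.
Proof. by move=> [f fi] [g gi]; exists (g \oc f); exact: is_iso_comp. Qed.

Definition orth X Y := forall f : hom X Y, f = 0.

Lemma orth_isol X X' Y : isomorphic X X' -> orth X Y -> orth X' Y.
Proof.
move=> [f [g [_ fg]]] o u.
by rewrite -(comp_idr u) -fg compA (o (u \oc f)) comp0l.
Qed.

Lemma orth_isor X Y Y' : isomorphic Y Y' -> orth X Y -> orth X Y'.
Proof.
move=> [f [g [_ fg]]] o u.
by rewrite -(comp_idl u) -fg -compA (o (g \oc u)) comp0r.
Qed.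

Lemma orth_zero X : orth X X <-> is_zero X.
Proof.
by split=> [|z f]; [exact | rewrite -(comp_idl f) (_ : idm X = 0) ?comp0l].
Qed.

Lemma is_zero_orthl X Y : is_zero X -> orth X Y.
Proof. by move=> z f; rewrite -(comp_idr f) (_ : idm X = 0) ?comp0r. Qed.

Lemma is_zero_orthr X Y : is_zero Y -> orth X Y.
Proof. by move=> z f; rewrite -(comp_idl f) (_ : idm Y = 0) ?comp0l. Qed.

Lemma is_zero_isomorphic X Y : is_zero X -> is_zero Y -> isomorphic X Y.
Proof.
by move=> zX zY; exists 0, 0; rewrite !comp0l zX zY.
Qed.

Lemma coproduct_ext (I : small) (F : I -> C) Z (inj : forall i, hom (F i) Z)
    W (u v : hom Z W) :
  is_coproduct inj -> (forall i, u \oc inj i = v \oc inj i) -> u = v.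
Proof.
by move=> cp uv; have [w [_ wu]] := cp W (fun i => v \oc inj i);
  rewrite -(wu u) // -(wu v).
Qed.

Lemma coproduct_map (I : small) (F : I -> C) Z (inj : forall i, hom (F i) Z)
    W (g : forall i, hom (F i) W) :
  is_coproduct inj -> exists u : hom Z W, forall i, u \oc inj i = g i.
Proof. by move=> cp; have [w [wg _]] := cp W g; exists w. Qed.

Lemma orth_coproduct (I : small) (F : I -> C) Z (inj : forall i, hom (F i) Z) Y :
  is_coproduct inj -> (forall i, orth (F i) Y) -> orth Z Y.
Proof.
move=> cp o f; apply: (coproduct_ext cp) => i.
by rewrite (o i (f \oc inj i)) comp0l.
Qed.

Lemma coproduct_proj (I : small) (F : I -> C) Z (inj : forall i, hom (F i) Z) i :
  is_coproduct inj ->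
  exists p : hom Z (F i),
    p \oc inj i = idm (F i) /\ forall j, j <> i -> p \oc inj j = 0.
Proof.
move=> cp.
pose g j : hom (F j) (F i) :=
  match pselect (i = j) with
  | left e => match e in _ = k return hom (F k) (F i) with erefl => idm (F i) end
  | right _ => 0 end.
have [p pg] := coproduct_map g cp; exists p; rewrite pg /g; split.
  by case: pselect => // e; rewrite (Prop_irrelevance e erefl).
by move=> j ji; rewrite pg /g; case: pselect => // e; case: ji.
Qed.

Lemma summand_retract X Z :
  direct_summand X Z ->
  exists (i : hom X Z) (p : hom Z X), p \oc i = idm X.
Proof. by move=> [Y [i [_ [p [_ [pi _ _ _ _]]]]]]; exists i, p. Qed.

Lemma orth_retractl X Z Y (i : hom X Z) (p : hom Z X) :
  p \oc i = idm X -> orth Z Y -> orth X Y.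
Proof.
by move=> pi o f; rewrite -(comp_idr f) -pi compA (o (f \oc p)) comp0l.
Qed.

Lemma orth_retractr X Z Y (i : hom X Z) (p : hom Z X) :
  p \oc i = idm X -> orth Y Z -> orth Y X.
Proof.
by move=> pi o f; rewrite -(comp_idl f) -pi -compA (o (i \oc f)) comp0r.
Qed.

(** Maps [K -> Z] that factor through a finite subcoproduct, encoded as formal sums so that no
    finite index set or biproduct has to be chosen. *)
Inductive finsum (I : small) (F : I -> C) Z (inj : forall i, hom (F i) Z) K :
    hom K Z -> Prop :=
| finsum0 : finsum inj 0
| finsum_cons i (y : hom K (F i)) x : finsum inj x -> finsum inj (inj i \oc y + x).

Section Finsum.
Variables (I : small) (F : I -> C) (Z : C) (inj : forall i, hom (F i) Z).
Implicit Types (i : I).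

Lemma finsumD K (x y : hom K Z) : finsum inj x -> finsum inj y -> finsum inj (x + y).
Proof.
by elim=> [|i z {}x _ IH] fy; rewrite ?add0r // -addrA; apply/finsum_cons/IH.
Qed.

Lemma finsum_inj K i (y : hom K (F i)) : finsum inj (inj i \oc y).
Proof. by rewrite -[_ \oc _]addr0; apply/finsum_cons/finsum0. Qed.

Lemma finsumN K (x : hom K Z) : finsum inj x -> finsum inj (- x).
Proof.
elim=> [|i z {}x _ IH]; first by rewrite oppr0; exact: finsum0.
by rewrite opprD -compNr; exact: finsum_cons.
Qed.

Lemma finsum_comp K K' (x : hom K Z) (a : hom K' K) :
  finsum inj x -> finsum inj (x \oc a).
Proof.
elim=> [|i z {}x _ IH]; first by rewrite comp0l; exact: finsum0.
by rewrite compDl -compA; exact: finsum_cons.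
Qed.

(* [e] is the projection of [Z] onto a finite subcoproduct through which [x]
   factors. *)
Lemma finsum_idem K (x : hom K Z) : is_coproduct inj -> finsum inj x ->
  exists e : hom Z Z, [/\ e \oc x = x,
    forall i, e \oc inj i = inj i \/ e \oc inj i = 0,
    forall K' (y : hom K' Z), finsum inj (e \oc y)
    & forall K' (y : hom K' Z), (forall i (p : hom Z (F i)), p \oc inj i = idm _ ->
        (forall j, j <> i -> p \oc inj j = 0) -> p \oc y = 0) -> e \oc y = 0].
Proof.
move=> cp; elim=> [|i y {}x _ [e [ex einj efin e0]]].
  exists 0; split=> [|i|K' y|K' y _]; rewrite ?comp0l //; first by right.
  exact: finsum0.
case: (einj i) => ei; first by exists e; rewrite compDr compA ei ex.
have [p [pi pj]] := coproduct_proj i cp.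
have pe : p \oc e = 0.
  apply: (coproduct_ext cp) => j; rewrite comp0l -compA.
  have [->|ji] := pselect (j = i); first by rewrite ei comp0r.
  by case: (einj j) => ->; rewrite ?comp0r ?pj.
exists (e + inj i \oc p); split=> [|j|K' z|K' z z0].
- have px : p \oc x = 0 by rewrite -ex compA pe comp0l.
  rewrite compDr !compDl ex -!(compA (inj i)) px compA ei (compA p) pi.
  by rewrite comp0l add0r comp_idl comp0r addr0.
- rewrite compDl -compA.
  have [->|ji] := pselect (j = i); first by rewrite ei pi comp_idr add0r; left.
  by rewrite pj // comp0r addr0; exact: einj.
- by rewrite compDl -compA; apply: finsumD => //; exact: finsum_inj.
- by rewrite compDl -compA (z0 i p) // e0 // comp0r addr0.
Qed.

(** The projections of an infinite coproduct need not be jointly monic. Finiteness of [x] repairs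
    this: the idempotent of [finsum_idem] fixes [x] and kills whatever all projections kill. *)
Lemma finsum_proj_inj K (x : hom K Z) : is_coproduct inj -> finsum inj x ->
  (forall i (p : hom Z (F i)), p \oc inj i = idm _ ->
    (forall j, j <> i -> p \oc inj j = 0) -> p \oc x = 0) -> x = 0.
Proof. by move=> cp /(finsum_idem cp) [e [ex _ _ e0]] /e0; rewrite ex. Qed.

End Finsum.

(** The factorization form of compactness. It does not quantify over abelian groups, and it passes
    directly to retracts, biproducts, shifts and extensions. *)
Definition fincompact K := forall (I : small) (F : I -> C) Z
  (inj : forall i, hom (F i) Z), is_coproduct inj -> forall x : hom K Z, finsum inj x.

Section CompactFincompact.
Variables (K : C) (I : small) (F : I -> C) (Z : C) (inj : forall i, hom (F i) Z).

Definition finsum_pred : {pred hom K Z} := fun x => `[< finsum inj x >].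

Lemma finsum_pred_closed : zmod_closed finsum_pred.
Proof.
split=> [|x y]; first by apply/asboolP/finsum0.
by move=> /asboolP fx /asboolP fy; apply/asboolP/finsumD/finsumN.
Qed.
HB.instance Definition _ := GRing.isZmodClosed.Build _ finsum_pred
  finsum_pred_closed.

Record finsum_group := FinsumGroup { finsum_val; _ : finsum_val \in finsum_pred }.
HB.instance Definition _ := [isSub for finsum_val].
HB.instance Definition _ := [Choice of finsum_group by <:].
HB.instance Definition _ := [SubChoice_isSubZmodule of finsum_group by <:].

Lemma finsum_val_is_additive : zmod_morphism finsum_val.
Proof. exact: (raddfB \val). Qed.
HB.instance Definition _ := GRing.isZmodMorphism.Build _ _ finsum_val
  finsum_val_is_additive.

Lemma finsum_pred_inj i (y : hom K (F i)) : inj i \oc y \in finsum_pred.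
Proof. exact/asboolP/finsum_inj. Qed.

Definition to_finsum i (y : hom K (F i)) : finsum_group :=
  FinsumGroup (finsum_pred_inj y).

Lemma to_finsum_is_additive i : zmod_morphism (@to_finsum i).
Proof. by move=> x y; apply: val_inj; rewrite raddfB /= compBr. Qed.
HB.instance Definition _ i := GRing.isZmodMorphism.Build _ _ (@to_finsum i)
  (@to_finsum_is_additive i).

Definition postcomp X Y W (g : hom Y W) (f : hom X Y) : hom X W := g \oc f.
Lemma postcomp_is_additive X Y W (g : hom Y W) : zmod_morphism (@postcomp X Y W g).
Proof. by move=> f f'; exact: compBr. Qed.
HB.instance Definition _ X Y W (g : hom Y W) := GRing.isZmodMorphism.Build _ _
  (@postcomp X Y W g) (@postcomp_is_additive X Y W g).

(* The finite sums form a subgroup containing the image of each [Hom(K, F i)],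
   so the universal property makes [Hom(K, Z)] a retract of it. *)
Lemma compact_finsum : compact K -> is_coproduct inj -> forall x : hom K Z, finsum inj x.
Proof.
move=> cK cp x.
have [psi [psiE _]] := cK _ _ _ _ cp _ (fun i => @to_finsum i).
have [chi [_ chiU]] := cK _ _ _ _ cp _ (fun i => @postcomp K (F i) Z (inj i)).
have xE : x = finsum_val (psi x).
  have /= -> := chiU (finsum_val \o psi) (fun i f => congr1 finsum_val (psiE i f)) x.
  exact: (chiU idfun (fun _ _ => erefl) x).
by rewrite xE; case: (psi x) => y /= /asboolP.
Qed.

End CompactFincompact.

Lemma compact_fincompact K : compact K -> fincompact K.
Proof. by move=> cK I F Z inj cp; exact: compact_finsum. Qed.

Lemma fincompact_retract K L (i : hom K L) (p : hom L K) :
  p \oc i = idm K -> fincompact L -> fincompact K.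
Proof.
move=> pi cL I F Z inj cp x; rewrite -(comp_idr x) -pi compA.
exact/finsum_comp/cL.
Qed.

Lemma fincompact_biproduct K L M :
  is_biproduct K L M -> fincompact K -> fincompact L -> fincompact M.
Proof.
move=> [i [j [p [q [_ _ _ _ e]]]]] cK cL I F Z inj cp x.
rewrite -(comp_idr x) -e compDr !compA.
by apply: finsumD; apply: finsum_comp; [exact: cK | exact: cL].
Qed.

End PreadditiveTheory.

(** * Shifts and triangles *)

Section Equivalence.
Variable C : preadditive.
Implicit Types X Y Z K : C.

(** Bundles the data relating [shift] and [unshift] so that, by [quasi_inverse_sym], each lemma on
    one functor applies to the other. *)
Definition quasi_inverse (F G : additive_endofunctor C) : Prop :=
  exists (a : forall X, hom X (F (G X))) (b : forall X, hom (G (F X)) X),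
    [/\ forall X, is_iso (a X),
        forall X Y (f : hom X Y), fmap F (fmap G f) \oc a X = a Y \oc f,
        forall X, is_iso (b X)
      & forall X Y (f : hom X Y), f \oc b X = b Y \oc fmap G (fmap F f)].

Lemma iso_natural_inv X Y X' Y' (a : hom X X') (b : hom Y Y') (a' : hom X' X)
    (b' : hom Y' Y) (f : hom X Y) (f' : hom X' Y') :
  a \oc a' = idm X' -> b' \oc b = idm Y ->
  f' \oc a = b \oc f -> f \oc a' = b' \oc f'.
Proof.
by move=> aa bb e; rewrite -[f']comp_idr -aa (compA f') e -compA compA bb comp_idl.
Qed.

Lemma quasi_inverse_sym F G : quasi_inverse F G -> quasi_inverse G F.
Proof.
move=> [a [b [ai an bi bn]]].
pose inva X := projT1 (cid (ai X)); pose invb X := projT1 (cid (bi X)).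
have invaP X : inva X \oc a X = idm X /\ a X \oc inva X = idm _.
  by rewrite /inva; case: cid.
have invbP X : invb X \oc b X = idm _ /\ b X \oc invb X = idm X.
  by rewrite /invb; case: cid.
exists invb, inva; split=> [X|X Y f|X|X Y f].
- by exists (b X); case: (invbP X).
- by apply: (iso_natural_inv (invbP X).2 (invbP Y).1); rewrite -bn.
- by exists (a X); case: (invaP X).
- by apply: (iso_natural_inv (invaP X).2 (invaP Y).1); rewrite an.
Qed.

Lemma functor_iso (F : additive_endofunctor C) X Y (f : hom X Y) :
  is_iso f -> is_iso (fmap F f).
Proof.
by move=> [g [gf fg]]; exists (fmap F g); rewrite -!fmap_comp gf fg !fmap_id.
Qed.

Lemma functor_isomorphic (F : additive_endofunctor C) X Y :
  isomorphic X Y -> isomorphic (F X) (F Y).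
Proof. by move=> [f fi]; exists (fmap F f); exact: functor_iso. Qed.

Lemma functor_zero (F : additive_endofunctor C) X : is_zero X -> is_zero (F X).
Proof. by rewrite /is_zero -fmap_id => ->; rewrite raddf0. Qed.

Lemma functor_biproduct (F : additive_endofunctor C) X Y Z :
  is_biproduct X Y Z -> is_biproduct (F X) (F Y) (F Z).
Proof.
move=> [i [j [p [q [h1 h2 h3 h4 h5]]]]].
exists (fmap F i), (fmap F j), (fmap F p), (fmap F q).
by rewrite -!fmap_comp -raddfD h1 h2 h3 h4 h5 !fmap_id !raddf0.
Qed.

Section EquivalenceTheory.
Variables F G : additive_endofunctor C.
Hypothesis FG : quasi_inverse F G.

Lemma functor_esssurj X : isomorphic X (F (G X)).
Proof. by have [a [_ [ai _ _ _]]] := FG; exists (a X). Qed.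

Lemma functor_faithful X Y (f g : hom X Y) : fmap F f = fmap F g -> f = g.
Proof.
have [_ [b [_ _ bi bn]]] := FG => e.
have [b' [_ bb]] := bi X.
by rewrite -[f]comp_idr -[g]comp_idr -bb !compA !bn e.
Qed.

End EquivalenceTheory.

Section EquivalenceTheory2.
Variables F G : additive_endofunctor C.
Hypothesis FG : quasi_inverse F G.

Lemma functor_full X Y (h : hom (F X) (F Y)) : exists f : hom X Y, fmap F f = h.
Proof.
have [_ [b [_ _ bi bn]]] := FG.
have [b' [b'b bb']] := bi X; have [c' [c'c cc']] := bi Y.
exists (b Y \oc fmap G h \oc b').
(* Both sides are compared after [G], which is faithful by symmetry; naturality of [b] undoes the
   conjugation. *)
apply: (functor_faithful (quasi_inverse_sym FG)).
rewrite -[LHS]comp_idl -c'c -compA -bn -!compA b'b comp_idr.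
by rewrite compA c'c comp_idl.
Qed.

Lemma functor_orth X Y : orth (F X) (F Y) <-> orth X Y.
Proof.
split=> o f; last by have [g <-] := functor_full f; rewrite (o g) raddf0.
by apply: (functor_faithful FG); rewrite (o (fmap F f)) raddf0.
Qed.

Lemma functor_coproduct (I : small) (X : I -> C) Z (inj : forall i, hom (X i) Z) :
  is_coproduct inj -> is_coproduct (fun i => fmap F (inj i)).
Proof.
move=> cp W g; have [v [v' [v'v vv']]] := functor_esssurj FG W.
have /dep_choice [g' g'E] : forall i, exists h : hom (X i) (G W), fmap F h = v \oc g i.
  by move=> i; exact: functor_full.
have [u ug] := coproduct_map g' cp.
exists (v' \oc fmap F u); split=> [i|w wg].
  by rewrite -compA -fmap_comp ug g'E compA v'v comp_idl.
rewrite -[w]comp_idl -v'v -compA; congr (_ \oc _).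
have [w' w'E] := functor_full (v \oc w); rewrite -w'E; congr (fmap F _).
apply: (coproduct_ext cp) => i; apply: (functor_faithful FG).
by rewrite !fmap_comp w'E -compA wg -fmap_comp ug g'E.
Qed.

Lemma finsum_functor_inv (I : small) (X : I -> C) Z (inj : forall i, hom (X i) Z)
    K (x : hom K Z) :
  finsum (fun i => fmap F (inj i)) (fmap F x) -> finsum inj x.
Proof.
move: {-2}(fmap F x) (erefl (fmap F x)) => y e fy; elim: fy x e => [|i z {}y _ IH] x.
  move=> e; rewrite (_ : x = 0); first exact: finsum0.
  by apply: (functor_faithful FG); rewrite raddf0 -e.
have [z' <-] := functor_full z; rewrite -fmap_comp => e.
rewrite -(subrK (inj i \oc z') x) addrC; apply/finsum_cons/IH.
by rewrite raddfB -e addrC addKr.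
Qed.

End EquivalenceTheory2.

(** A map from [F K] is tested after [G]: its source becomes [K] up to isomorphism, and coproducts
    stay coproducts. *)
Lemma functor_fincompact F G K :
  quasi_inverse F G -> fincompact K -> fincompact (F K).
Proof.
move=> FG cK I X Z inj cp x; have GF := quasi_inverse_sym FG.
apply: (finsum_functor_inv GF).
have [b [b' [b'b bb']]] := isomorphic_sym (functor_esssurj GF K).
rewrite -[fmap G x]comp_idr -b'b compA; apply/finsum_comp/cK.
exact: (functor_coproduct GF).
Qed.

End Equivalence.

Section TriangulatedTheory.
Variable T : triangulated.
Implicit Types X Y Z W K : T.
Notation S := (shift T).
Notation U := (unshift T).

Lemma shift_unshift : quasi_inverse S U.
Proof.
exists (@shift_unit T), (@shift_counit T).
split; [exact: shift_unit_iso | exact: shift_unit_nat | exact: shift_counit_iso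
  | exact: shift_counit_nat].
Qed.
Definition unshift_shift := quasi_inverse_sym shift_unshift.

Lemma sh_succ X n : isomorphic (sh X (n + 1)) (S (sh X n)).
Proof.
case: n => [n|[|n]].
- by rewrite (_ : Posz n + 1 = Posz n.+1); [exact: isomorphic_refl | lia].
- exact: functor_esssurj shift_unshift X.
- rewrite (_ : Negz n.+1 + 1 = Negz n); last lia.
  exact: functor_esssurj shift_unshift (sh X (Negz n)).
Qed.

Lemma sh_pred X n : isomorphic (sh X (n - 1)) (U (sh X n)).
Proof.
have := sh_succ X (n - 1); rewrite subrK => e.
apply: isomorphic_trans (functor_isomorphic U (isomorphic_sym e)).
exact: functor_esssurj unshift_shift _.
Qed.

(** The shift is only an equivalence, so in general [sh X (n + 1)] and the shift of [sh X n] agree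
    only up to isomorphism. Induction on [n] therefore asks [P] to be invariant under
    isomorphism. *)
Lemma sh_ind (P : int -> T -> T -> Prop) X Y :
  (forall n X' Y' X'' Y'', isomorphic X' X'' -> isomorphic Y' Y'' ->
    P n X' Y' -> P n X'' Y'') ->
  P 0 X Y ->
  (forall n X' Y', P n X' Y' -> P (n + 1) (S X') (S Y')) ->
  (forall n X' Y', P n X' Y' -> P (n - 1) (U X') (U Y')) ->
  forall n, P n (sh X n) (sh Y n).
Proof.
move=> Pi P0 PS PU; elim/int_ind => [|n IH|n IH] //.
  rewrite -addn1 PoszD.
  by apply: Pi (PS _ _ _ IH); apply/isomorphic_sym/sh_succ.
rewrite -addn1 PoszD opprD.
by apply: Pi (PU _ _ _ IH); apply/isomorphic_sym/sh_pred.
Qed.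

Lemma sh_isomorphic X Y n : isomorphic X Y -> isomorphic (sh X n) (sh Y n).
Proof.
move=> XY; apply: (sh_ind (P := fun _ => @isomorphic T)) => // [_ A B A' B' a b ab|_ A B|_ A B].
- exact: isomorphic_trans (isomorphic_trans (isomorphic_sym a) ab) b.
- exact: functor_isomorphic.
- exact: functor_isomorphic.
Qed.

Lemma sh_add X a b : isomorphic (sh (sh X a) b) (sh X (a + b)).
Proof.
elim/int_ind: b => [|b IH|b IH]; first by rewrite addr0; exact: isomorphic_refl.
  rewrite -addn1 PoszD addrA.
  apply: isomorphic_trans (sh_succ _ _) (isomorphic_trans _ (isomorphic_sym (sh_succ _ _))).
  exact: functor_isomorphic.
rewrite -addn1 PoszD opprD addrA.
apply: isomorphic_trans (sh_pred _ _) (isomorphic_trans _ (isomorphic_sym (sh_pred _ _))).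
exact: functor_isomorphic.
Qed.

Lemma sh_opp X a b : a + b = 0 -> isomorphic (sh (sh X a) b) X.
Proof. by move=> e; have := sh_add X a b; rewrite e. Qed.

Lemma sh_eqadd X a b c : a + b = c -> isomorphic (sh (sh X a) b) (sh X c).
Proof. by move=> <-; exact: sh_add. Qed.

Lemma orth_iso X X' Y Y' :
  isomorphic X X' -> isomorphic Y Y' -> orth X Y -> orth X' Y'.
Proof. by move=> a b o; apply: orth_isol a _; apply: orth_isor b _. Qed.

Lemma orth_sh X Y n : orth (sh X n) (sh Y n) <-> orth X Y.
Proof.
have im m (A B : T) : orth A B -> orth (sh A m) (sh B m).
  move=> o; refine (@sh_ind (fun _ => @orth T) A B _ o _ _ m).
  - by move=> _ A1 B1 A' B' a b; exact: orth_iso.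
  - by move=> _ A1 B1; rewrite (functor_orth shift_unshift).
  - by move=> _ A1 B1; rewrite (functor_orth unshift_shift).
split=> [/(im (- n))|]; last exact: im.
by apply: orth_iso; apply: sh_opp; rewrite subrr.
Qed.

Lemma orth_shl X Y a b : a + b = 0 -> orth (sh X a) Y <-> orth X (sh Y b).
Proof.
move=> e; rewrite -(orth_sh (sh X a) Y b).
have i := sh_opp X e.
by split; apply: orth_isol; [exact: i | exact: isomorphic_sym].
Qed.

Lemma orth_shift X Y a b c :
  b - a = c -> orth (sh X a) (sh Y b) <-> orth X (sh Y c).
Proof.
move=> e; rewrite (@orth_shl X (sh Y b) a (- a)) ?subrr //.
have i := sh_eqadd Y e.
by split; apply: orth_isor; [exact: i | exact: isomorphic_sym].
Qed.

Lemma is_zero_sh X n : is_zero (sh X n) <-> is_zero X.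
Proof. by rewrite -!orth_zero orth_sh. Qed.

Lemma fincompact_iso X Y : isomorphic X Y -> fincompact X -> fincompact Y.
Proof. by move=> [f [g [gf fg]]]; exact: fincompact_retract fg. Qed.

Lemma fincompact_sh X n : fincompact X -> fincompact (sh X n).
Proof.
move=> c; apply: (sh_ind (Y := X) (P := fun _ Y _ => fincompact Y)) => //.
- by move=> _ A B A' B' a _; exact: fincompact_iso.
- by move=> _ A _; exact: (functor_fincompact shift_unshift).
- by move=> _ A _; exact: (functor_fincompact unshift_shift).
Qed.

Definition coproduct_of (I : small) (F : I -> T) Z :=
  exists inj : forall i, hom (F i) Z, is_coproduct inj.

Lemma coproduct_of_iso (I : small) (F F' : I -> T) Z Z' :
  (forall i, isomorphic (F i) (F' i)) -> isomorphic Z Z' ->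
  coproduct_of F Z -> coproduct_of F' Z'.
Proof.
move=> /dep_choice[a /dep_choice[a' aa']] [f [f' [f'f ff']]] [inj cp].
exists (fun i => f \oc inj i \oc a' i) => W g.
have [u ug] := coproduct_map (fun i => g i \oc a i) cp.
exists (u \oc f'); split=> [i|v vg].
  by rewrite !compA -(compA u) f'f comp_idr ug -compA (aa' i).2 comp_idr.
rewrite -[v]comp_idr -ff' compA; congr (_ \oc _); apply: (coproduct_ext cp) => i.
by rewrite ug -vg !compA -compA (aa' i).1 comp_idr.
Qed.

Lemma coproduct_of_sh (I : small) (F : I -> T) Z n :
  coproduct_of F Z -> coproduct_of (fun i => sh (F i) n) (sh Z n).
Proof.
move=> c; elim/int_ind: n => [//|n [inj cp]|n [inj cp]].
  rewrite -addn1 PoszD.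
  apply: (@coproduct_of_iso I (fun i => S (sh (F i) n)) _ (S (sh Z n))).
  - by move=> i; apply/isomorphic_sym/sh_succ.
  - by apply/isomorphic_sym/sh_succ.
  - by exists (fun i => fmap S (inj i)); apply: (functor_coproduct shift_unshift).
rewrite -addn1 PoszD opprD.
apply: (@coproduct_of_iso I (fun i => U (sh (F i) (- n%:Z))) _ (U (sh Z (- n%:Z)))).
- by move=> i; apply/isomorphic_sym/sh_pred.
- by apply/isomorphic_sym/sh_pred.
- by exists (fun i => fmap U (inj i)); apply: (functor_coproduct unshift_shift).
Qed.

Lemma direct_summand_sh X Z n :
  direct_summand X Z -> direct_summand (sh X n) (sh Z n).
Proof.
apply: (sh_ind (P := fun _ A B => direct_summand X Z -> direct_summand A B)) => //.
- move=> _ A B A' B' [a [a' [a'a aa']]] [b [b' [b'b bb']]] s /s.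
  move=> [D [i [j [p [q [h1 h2 h3 h4 h5]]]]]].
  exists D, (b \oc i \oc a'), (b \oc j), (a \oc p \oc b'), (q \oc b').
  have bb X1 X2 (f : hom X1 B) (g : hom B X2) : g \oc b' \oc (b \oc f) = g \oc f.
    by rewrite -compA (compA b') b'b comp_idl.
  split; rewrite -?(compA b) ?bb.
  + by rewrite -(compA a) (compA p) h1 comp_idl.
  + by [].
  + by rewrite compA h3 comp0l.
  + by rewrite -compA h4 comp0r.
  + rewrite -!compA (compA a') a'a comp_idl -compDr.
    by rewrite !compA -compDl h5 comp_idl.
- by move=> _ A B IH /IH [D s]; exists (S D); exact: functor_biproduct.
- by move=> _ A B IH /IH [D s]; exists (U D); exact: functor_biproduct.
Qed.

Lemma triangle_rot X Y Z (f : hom X Y) (g : hom Y Z) (h : hom Z (S X)) :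
  triangle f g h -> triangle g h (- fmap S f).
Proof. by move/TR2. Qed.

(** TR3, applied from the triangle on [idm X], factors the composite through a zero object. *)
Lemma triangle_comp X Y Z (f : hom X Y) (g : hom Y Z) (h : hom Z (S X)) :
  triangle f g h -> g \oc f = 0.
Proof.
move=> t; have [O zO] := zero_ex T.
have [|c [e _]] := TR3 (a := idm X) (b := f) (TR1_id X zO) t; first by [].
by rewrite -e comp0r.
Qed.

(** TR3 between the rotated triangles on [idm W] and on [f] yields a map of shifts, which fullness
    of the shift desuspends. *)
Lemma triangle_exactl W X Y Z (f : hom X Y) (g : hom Y Z) (h : hom Z (S X))
    (x : hom W Y) :
  triangle f g h -> g \oc x = 0 -> exists y : hom W X, x = f \oc y.
Proof.
move=> t gx; have [O zO] := zero_ex T.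
have [|c [_]] := TR3 (a := x) (b := (0 : hom O Z)) (triangle_rot (TR1_id W zO))
  (triangle_rot t); first by rewrite gx comp0r.
have [y <-] := functor_full shift_unshift c.
rewrite compNl compNr fmap_id comp_idr -fmap_comp => /oppr_inj /(functor_faithful shift_unshift).
by exists y.
Qed.

Lemma triangle_exactr W X Y Z (f : hom X Y) (g : hom Y Z) (h : hom Z (S X))
    (y : hom Y W) :
  triangle f g h -> y \oc f = 0 -> exists z : hom Z W, y = z \oc g.
Proof.
move=> t yf; have [O zO] := zero_ex T.
have tO : triangle (0 : hom O W) (idm W) (0 : hom W (S O)).
  apply/TR2; rewrite (_ : - fmap S 0 = 0); first by apply/TR1_id/functor_zero.
  by apply: (is_zero_orthl (functor_zero S zO)).
have [|c [e _]] := TR3 (a := (0 : hom X O)) (b := y) t tO; first by rewrite yf comp0r.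
by exists c; rewrite e comp_idl.
Qed.

Definition extension X Z Y : Prop :=
  exists (f : hom X Z) (g : hom Z Y) (h : hom Y (S X)), triangle f g h.

Lemma extension_iso X Z Y X' Z' Y' :
  isomorphic X X' -> isomorphic Z Z' -> isomorphic Y Y' ->
  extension X Z Y -> extension X' Z' Y'.
Proof.
move=> [a ai] [b bi] [c ci] [f [g [h t]]].
have [a' [a'a aa']] := ai; have [b' [b'b bb']] := bi; have [c' [c'c cc']] := ci.
exists (b \oc f \oc a'), (c \oc g \oc b'), (fmap S a \oc h \oc c').
apply: TR1_iso ai bi ci _ _ _ t.
- by rewrite -!compA a'a comp_idr.
- by rewrite -!compA b'b comp_idr.
- by rewrite -!compA c'c comp_idr.
Qed.

Lemma extension_rot X Z Y : extension X Z Y -> extension Z Y (sh X 1).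
Proof. by move=> [f [g [h t]]]; exists g, h, (- fmap S f); exact: triangle_rot. Qed.

(** Backward rotation. As the shift is not invertible on the nose, [Y] is replaced by the shift of
    its unshift, and [b] records the comparison. *)
Lemma triangle_rotV X Z Y (f : hom X Z) (g : hom Z Y) (h : hom Y (S X)) :
  triangle f g h ->
  exists (a : hom (U Y) X) (k : hom Z (S (U Y))) (b : hom (S (U Y)) Y),
    [/\ triangle a f k, is_iso b, b \oc k = g & - fmap S a = h \oc b].
Proof.
move=> t; have [b [b' [b'b bb']]] := isomorphic_sym (functor_esssurj shift_unshift Y).
have [a aE] := functor_full shift_unshift (- (h \oc b)).
exists a, (b' \oc g), b; split.
- apply/TR2; refine (TR1_iso (is_iso_id X) (is_iso_id Z) (_ : is_iso b') _ _ _ t).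
  + by exists b.
  + by rewrite comp_idl comp_idr.
  + by rewrite comp_idr.
  + by rewrite aE opprK fmap_id comp_idl -compA bb' comp_idr.
- by exists b'.
- by rewrite compA bb' comp_idl.
- by rewrite aE opprK.
Qed.

Lemma functor_reflects_iso F G X Y (f : hom X Y) :
  @quasi_inverse T F G -> is_iso (fmap F f) -> is_iso f.
Proof.
move=> FG [g' [gf fg]]; have [g gE] := functor_full FG g'.
by exists g; split; apply: (functor_faithful FG); rewrite fmap_comp gE fmap_id.
Qed.

(** Complete [h] to a triangle by its cone and rotate back twice; [m0] desuspends the comparison
    isomorphism, so that the triangle starts at [X] itself. *)
Lemma triangle_from X Y (h : hom Y (S X)) :
  exists Z (f : hom X Z) (g : hom Z Y), triangle f g h.
Proof.
have [W [a [b t]]] := TR1_cone h.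
have [c [k [_ [t1 _ _ _]]]] := triangle_rotV t.
have [d [k' [m [t2 mi mk _]]]] := triangle_rotV t1.
have [m0 m0E] := functor_full shift_unshift m.
have m0i : is_iso m0 by apply: (functor_reflects_iso shift_unshift); rewrite m0E.
have [m0' [m'm mm']] := m0i.
exists (U W), (d \oc m0'), c.
apply: TR1_iso m0i (is_iso_id _) (is_iso_id _) _ _ _ t2.
- by rewrite comp_idl -compA m'm comp_idr.
- by rewrite comp_idl comp_idr.
- by rewrite m0E mk comp_idr.
Qed.

Lemma TR3_left X Z Y X' Z' Y' (f : hom X Z) (g : hom Z Y) (h : hom Y (S X))
    (f' : hom X' Z') (g' : hom Z' Y') (h' : hom Y' (S X'))
    (b : hom Z Z') (c : hom Y Y') :
  triangle f g h -> triangle f' g' h' -> g' \oc b = c \oc g ->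
  exists a : hom X X', f' \oc a = b \oc f /\ fmap S a \oc h = h' \oc c.
Proof.
move=> t t' e.
have [d [dh]] := TR3 (triangle_rot t) (triangle_rot t') (esym e).
have [a aE] := functor_full shift_unshift d; move: dh; rewrite -aE => dh.
rewrite compNl compNr -!fmap_comp => /oppr_inj /(functor_faithful shift_unshift) fa.
by exists a.
Qed.

Lemma TR3_mid X Z Y X' Z' Y' (f : hom X Z) (g : hom Z Y) (h : hom Y (S X))
    (f' : hom X' Z') (g' : hom Z' Y') (h' : hom Y' (S X'))
    (a : hom X X') (c : hom Y Y') :
  triangle f g h -> triangle f' g' h' -> fmap S a \oc h = h' \oc c ->
  exists b : hom Z Z', b \oc f = f' \oc a /\ g' \oc b = c \oc g.
Proof.
move=> t t' e.
have [d [df dg]] := TR3 (triangle_rot (triangle_rot t)) (triangle_rot (triangle_rot t')) e.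
have [b bE] := functor_full shift_unshift d; move: df dg; rewrite -bE.
rewrite !compNl !compNr -!fmap_comp.
move=> /oppr_inj/(functor_faithful shift_unshift) fb.
by move=> /oppr_inj/(functor_faithful shift_unshift) gb; exists b.
Qed.

Lemma extension_rotV X Z Y : extension X Z Y -> extension (sh Y (- 1)) X Z.
Proof.
move=> [f [g [h t]]]; have [a [k [b [t' _ _ _]]]] := triangle_rotV t.
by exists a, f, k.
Qed.

Lemma extension_sh X Z Y n :
  extension X Z Y -> extension (sh X n) (sh Z n) (sh Y n).
Proof.
move=> e; elim/int_ind: n => [//|n IH|n IH].
  have := extension_rot (extension_rot (extension_rot IH)).
  by rewrite -addn1 PoszD; apply: extension_iso; exact: sh_eqadd.
have := extension_rotV (extension_rotV (extension_rotV IH)).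
by rewrite -addn1 PoszD opprD; apply: extension_iso; exact: sh_eqadd.
Qed.

Lemma orth_extl X Z Y W : extension X Z Y -> orth X W -> orth Y W -> orth Z W.
Proof.
move=> [f [g [h t]]] oX oY u.
have [|v ->] := triangle_exactr (y := u) t; first exact: oX.
by rewrite (oY v) comp0l.
Qed.

Lemma orth_extr X Z Y W : extension X Z Y -> orth W X -> orth W Y -> orth W Z.
Proof.
move=> [f [g [h t]]] oX oY u.
have [|v ->] := triangle_exactl (x := u) t; first exact: oY.
by rewrite (oX v) comp0r.
Qed.

Lemma cone_zero X Z Y (f : hom X Z) (g : hom Z Y) (h : hom Y (S X)) :
  triangle f g h -> is_zero Y -> is_iso f.
Proof.
move=> t zY.
have [|u uE] := triangle_exactl (x := idm Z) t; first by apply: is_zero_orthr.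
exists u; split=> //.
apply: (functor_faithful shift_unshift); apply/eqP; rewrite -subr_eq0 -raddfB.
apply/eqP.
have [|v ->] := triangle_exactl (x := fmap S (u \oc f - idm X)) (triangle_rot (triangle_rot t)).
  by rewrite compNl -fmap_comp compBr compA -uE comp_idl comp_idr subrr raddf0 oppr0.
by rewrite (is_zero_orthr zY v) comp0r.
Qed.

(** With [g = 0] the identity of [Y] factors through [h], hence through a map [S X -> Y], which is
    zero; so [Y] vanishes. *)
Lemma cone_of_iso X Z Y (f : hom X Z) (g : hom Z Y) (h : hom Y (S X)) :
  triangle f g h -> orth (S X) Y -> g = 0 -> is_iso f.
Proof.
move=> t o g0; apply: (cone_zero t).
have [|u e] := triangle_exactr (y := idm Y) (triangle_rot t).
  by rewrite g0 comp0r.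
by rewrite /is_zero e (o u) comp0l.
Qed.

Lemma fiber_zero_iso X Z Y (f : hom X Z) (g : hom Z Y) (h : hom Y (S X)) :
  triangle f g h -> orth (S X) Y -> f = 0 -> is_iso g.
Proof.
move=> t o f0; apply: (cone_zero (triangle_rot t)).
have [|u e] := triangle_exactl (x := idm (S X)) (triangle_rot (triangle_rot t)).
  by rewrite f0 raddf0 oppr0 comp0l.
by rewrite /is_zero e (o u) comp0r.
Qed.

Lemma retract_summand X Z (i : hom X Z) (p : hom Z X) :
  p \oc i = idm X -> direct_summand X Z.
Proof.
move=> pi; have [Y [g [h t]]] := TR1_cone i.
have [|q qE] := triangle_exactr (y := idm Z - i \oc p) t.
  by rewrite compBl comp_idl -compA pi comp_idr subrr.
have gi := triangle_comp t.
exists Y, i, q, p, g.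
(* The map [g] is epi because [h = 0]: the shift of [i] kills [h], and [i] is split mono. *)
have inj W (a b : hom Y W) : a \oc g = b \oc g -> a = b.
  move=> e; apply/eqP; rewrite -subr_eq0; apply/eqP.
  have [|c ->] := triangle_exactr (y := a - b) (triangle_rot t).
    by rewrite compBl e subrr.
  have h0 : h = 0.
    have := triangle_comp (triangle_rot (triangle_rot t)).
    rewrite compNl => /eqP; rewrite oppr_eq0 => /eqP e0.
    by rewrite -[h]comp_idl -fmap_id -pi fmap_comp -compA e0 comp0r.
  by rewrite h0 comp0r.
split=> //.
- by apply: inj; rewrite -compA -qE compBr comp_idr compA gi comp0l subr0 comp_idl.
- by apply: inj; rewrite -compA -qE compBr comp_idr compA pi comp_idl subrr comp0l.
- by rewrite -qE addrC subrK.
Qed.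

Lemma biproduct_coproduct X Y Z : is_biproduct X Y Z ->
  coproduct_of (fun b : bool => if b then X else Y) Z.
Proof.
move=> [i [j [p [q [pi qj qi pj e]]]]].
pose inj (b : bool) : hom (if b then X else Y) Z :=
  match b with true => i | false => j end.
exists inj => W g; exists (g true \oc p + g false \oc q); split=> [[]|v vg] /=.
- by rewrite compDl -!compA pi qi comp0r addr0 comp_idr.
- by rewrite compDl -!compA pj qj comp0r add0r comp_idr.
- by rewrite -(vg true) -(vg false) /= -!compA -compDr e comp_idr.
Qed.

(** An idempotent [e] with finite image fixes [x \oc f], so [x - e \oc x] vanishes on [X] and
    factors through [Y]; both pieces of [x] are finite sums. *)
Lemma fincompact_extension X Z Y :
  extension X Z Y -> fincompact X -> fincompact Y -> fincompact Z.
Proof.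
move=> [f [g [h t]]] cX cY I F W inj cp x.
have [e [ex _ efin _]] := finsum_idem cp (cX _ _ _ _ cp (x \oc f)).
have [|y yE] := triangle_exactr (y := x - e \oc x) t.
  by rewrite compBl -compA ex subrr.
rewrite -(subrK (e \oc x) x) yE; apply: finsumD => //.
exact/finsum_comp/cY.
Qed.

End TriangulatedTheory.

(** * Homotopy colimits and approximation *)

Section Generated.
Variable T : triangulated.
Implicit Types X Y Z W K G : T.

Lemma gen_ext G J X Z Y :
  extension X Z Y -> generated G J X -> generated G J Y -> generated G J Z.
Proof. by move=> [f [g [h t]]]; exact: gen_extension t. Qed.

Lemma gen_coproduct_of G J (I : small) (F : I -> T) Z :
  coproduct_of F Z -> (forall i, generated G J (F i)) -> generated G J Z.
Proof. by move=> [inj cp]; exact: gen_coproduct cp. Qed.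

Lemma gen_zero G J Z : is_zero Z -> generated G J Z.
Proof.
move=> zZ; apply: (@gen_coproduct_of G J void (of_void T)) => [|[]].
exists (fun i : void => match i return hom (of_void T i) Z with end) => W g.
by exists 0; split=> [[]|u _]; rewrite (is_zero_orthl zZ u).
Qed.

Lemma gen_retract G J X Z (i : hom X Z) (p : hom Z X) :
  p \oc i = idm X -> generated G J Z -> generated G J X.
Proof. by move=> /retract_summand; exact: gen_summand. Qed.

Lemma gen_trans G J G' J' X :
  (forall i, i \in J' -> generated G J (sh G' (- i))) ->
  generated G' J' X -> generated G J X.
Proof.
move=> h; elim=> {X} [i /h //|X Y i _|X Z s _|I F Z inj cp _|X Z Y f g k t _ gX _ gY].
- exact: gen_iso.
- exact: gen_summand.
- exact: gen_coproduct cp.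
- exact: gen_extension t gX gY.
Qed.

Lemma gen_baseW G J k X : isomorphic (sh G k) X -> - k \in J -> generated G J X.
Proof.
move=> i kJ; apply: gen_iso i _.
by have := gen_base G kJ; rewrite opprK.
Qed.

Lemma gen_mono G J J' X :
  (forall i, i \in J -> i \in J') -> generated G J X -> generated G J' X.
Proof. by move=> s; apply: gen_trans => i /s; exact: gen_base. Qed.

Lemma gen_sh G J J' k X :
  (forall i, i \in J -> i - k \in J') ->
  generated G J X -> generated G J' (sh X k).
Proof.
move=> s; elim=> {X} [i /s ik|X Y i _|X Z i _|I F Z inj cp _ IH|X Z Y f g h t _ gX _ gY].
- by apply: gen_baseW (isomorphic_sym (sh_add _ _ _)) _; rewrite opprD opprK.
- by apply: gen_iso; exact: sh_isomorphic.
- by apply: gen_summand; exact: direct_summand_sh.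
- by apply: (gen_coproduct_of (coproduct_of_sh k _) IH); exists inj.
- by apply: (gen_ext (extension_sh k _) gX gY); exists f, g, h.
Qed.

Lemma gen_orthl G J X Y :
  (forall i, i \in J -> orth (sh G (- i)) Y) -> generated G J X -> orth X Y.
Proof.
move=> h; elim=> {X} [i /h //|X X' i _|X Z /summand_retract[i [p pi]] _
  |I F Z inj cp _|X Z X' f g k t _ gX _ gY].
- exact: orth_isol i.
- exact: orth_retractl pi.
- exact: orth_coproduct cp.
- by apply: (orth_extl _ gX gY); exists f, g, k.
Qed.

Lemma orth_fincompact K (I : small) (F : I -> T) Z : fincompact K ->
  coproduct_of F Z -> (forall i, orth K (F i)) -> orth K Z.
Proof.
move=> cK [inj cp] o x; elim: (cK _ _ _ _ cp x) => // i y {}x _ ->.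
by rewrite (o i y) comp0r addr0.
Qed.

(** The right-hand counterpart of [gen_orthl]; closure of the vanishing locus under coproducts comes
    from compactness of [K]. *)
Lemma gen_orthr K G J X : fincompact K ->
  (forall i, i \in J -> orth K (sh G (- i))) -> generated G J X -> orth K X.
Proof.
move=> cK h; elim=> {X} [i /h //|X X' i _|X Z /summand_retract[i [p pi]] _
  |I F Z inj cp _|X Z X' f g k t _ gX _ gY].
- exact: orth_isor i.
- exact: orth_retractr pi.
- by apply: orth_fincompact => //; exists inj.
- by apply: (orth_extr _ gX gY); exists f, g, k.
Qed.

Lemma gen_zero_crit G X : compact_generator G ->
  (forall i, orth (sh G i) X) -> is_zero X.
Proof.
by move=> [_ gG] o; apply/orth_zero; apply: gen_orthl (gG X) => i _; exact: o.
Qed.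

End Generated.

Section Hocolim.
Variable T : triangulated.
Implicit Types X Y Z W K G : T.

(** The working properties of a homotopy colimit: a cocone with the weak universal property
    (existence only), the defining triangle in rotated form, and the lifting of maps from compact
    objects to a finite stage. *)
Record is_hocolim (A : nat -> T) (t : forall n, hom (A n) (A n.+1)) (H : T)
    (e : forall n, hom (A n) H) : Prop := IsHocolim {
  hocolim_comp : forall n, e n.+1 \oc t n = e n;
  hocolim_map : forall W (w : forall n, hom (A n) W),
    (forall n, w n.+1 \oc t n = w n) -> exists u : hom H W, forall n, u \oc e n = w n;
  hocolim_ext : exists2 Z, coproduct_of A Z & extension Z H (sh Z 1);
  hocolim_lift : forall K, fincompact K ->
    forall x : hom K H, exists n (y : hom K (A n)), x = e n \oc y
}.

Lemma cocone_push (A : nat -> T) (t : forall n, hom (A n) (A n.+1)) H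
    (e : forall n, hom (A n) H) K n m (y : hom K (A n)) :
  (forall n, e n.+1 \oc t n = e n) -> (n <= m)%N ->
  exists y' : hom K (A m), e n \oc y = e m \oc y'.
Proof.
move=> et /subnK <-; elim: (m - n)%N => [|k [y' ->]]; first by exists y.
by exists (t _ \oc y'); rewrite compA et.
Qed.

Section Telescope.
Variables (A : nat -> T) (t : forall n, hom (A n) (A n.+1)).
Variables (Z : T) (inj : forall n, hom (A n) Z) (u : hom Z Z).
Hypothesis cp : @is_coproduct T nat A Z inj.
Hypothesis uE : forall n, u \oc inj n = inj n - inj n.+1 \oc t n.

(** The map [u] is identity minus shift. Its n-th coordinate is the n-th projection minus [t]
    applied to the previous one, so induction on [n] kills every coordinate of [y], which is a
    finite sum and hence zero. *)
Lemma telescope_inj K (y : hom K Z) : fincompact K -> u \oc y = 0 -> y = 0.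
Proof.
move=> cK uy; apply: (finsum_proj_inj cp (cK _ _ _ _ cp y)).
elim=> [|n IH] p pn pj.
  suff pu : p \oc u = p by rewrite -pu -compA uy comp0r.
  apply: (coproduct_ext cp) => j; rewrite -compA uE compBr compA.
  by rewrite (pj j.+1) // comp0l subr0.
have [q [qn qj]] := coproduct_proj n cp.
suff pu : p \oc u = p - t n \oc q.
  have := comp0r K p; rewrite -[X in p \oc X]uy compA pu compBl -compA IH //.
  by rewrite comp0r subr0.
apply: (coproduct_ext cp) => j; rewrite -compA uE compBr compBl.
congr (_ - _); rewrite compA -[RHS]compA.
have [->|/eqP jn] := eqVneq j n; first by rewrite pn qn comp_idl comp_idr.
by rewrite qj // comp0r pj ?comp0l // => -[].
Qed.

End Telescope.

Hypothesis coprods : has_small_coproducts T.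

Lemma hocolim_ex (A : nat -> T) (t : forall n, hom (A n) (A n.+1)) :
  exists (H : T) (e : forall n, hom (A n) H), is_hocolim t e.
Proof.
have [Z [inj cp]] := @coprods nat A.
have [u uE] := coproduct_map (fun n => inj n - inj n.+1 \oc t n) cp.
have [H [g [h tr]]] := TR1_cone u.
have et n : g \oc inj n.+1 \oc t n = g \oc inj n.
  apply/esym/eqP; rewrite -subr_eq0 -compA -compBr -uE compA.
  by rewrite (triangle_comp tr) comp0l.
exists H, (fun n => g \oc inj n); split=> //.
- move=> W w wt; have [v vw] := coproduct_map w cp.
  have [|s vE] := triangle_exactr (y := v) tr.
    apply: (coproduct_ext cp) => n.
    by rewrite -compA uE compBr compA !vw wt subrr comp0l.
  by exists s => n; rewrite compA -vE.
- exists Z; first by exists inj.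
  by exists g, h, (- fmap (shift T) u); exact: triangle_rot.
move=> K cK x.
(* The boundary [h \oc x] is killed by the shift of [u]; once desuspended it vanishes by
   [telescope_inj], so [x] lifts to the coproduct [Z]. *)
have [|z ->] := triangle_exactl (x := x) (triangle_rot tr).
  have [b [b' [b'b bb']]] := isomorphic_sym (functor_esssurj (shift_unshift T) K).
  have [y yE] := functor_full (shift_unshift T) (h \oc x \oc b).
  rewrite -[LHS]comp_idr -bb' compA -yE (_ : y = 0) ?raddf0 ?comp0l //.
  apply: (telescope_inj cp uE).
    exact: functor_fincompact (unshift_shift T) cK.
  apply: (functor_faithful (shift_unshift T)); rewrite raddf0 fmap_comp yE !compA.
  have := triangle_comp (triangle_rot (triangle_rot tr)).
  by rewrite compNl => /eqP; rewrite oppr_eq0 => /eqP ->; rewrite !comp0l.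
(* The finitely many summands of [z] are pushed to a common stage. *)
elim: (cK _ _ _ _ cp z) => [|i y {}z _ [n [y' yE]]].
  by exists 0%N, 0; rewrite !comp0r.
rewrite compDr yE compA.
have [a ->] := cocone_push y et (leq_maxl i n).
have [b ->] := cocone_push y' et (leq_maxr i n).
by exists (maxn i n), (a + b); rewrite -compDr.
Qed.

Lemma hocolim_orth (A : nat -> T) (t : forall n, hom (A n) (A n.+1)) H
    (e : forall n, hom (A n) H) K : is_hocolim t e -> fincompact K ->
  (forall n, exists2 m, (n <= m)%N & orth K (A m)) -> orth K H.
Proof.
move=> hc cK o x; have [n [y ->]] := hocolim_lift hc cK x.
have [m nm om] := o n.
have [y' ->] := cocone_push y (hocolim_comp hc) nm.
by rewrite (om y') comp0r.
Qed.

(** * Cellular approximation of an object by shifts of a compact object *)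

Section Approximation.
Variables (G X : T) (S : int -> Prop) (P : T -> Prop).
Hypothesis G_compact : fincompact G.
Hypothesis P_coproduct : forall (I : small) (k : I -> int) Z,
  (forall i, S (k i)) -> coproduct_of (fun i => sh G (k i)) Z -> P Z.
Hypothesis P_ext : forall Z Z' Z'', extension Z Z' Z'' -> P Z -> P Z'' -> P Z'.

Record approx_stage := ApproxStage {
  stage_obj :> T;
  stage_map : hom stage_obj X;
  stage_in : P stage_obj
}.

Lemma approx_stage0 : exists s : approx_stage,
  forall i, S i -> forall f : hom (sh G i) X, exists f', f = stage_map s \oc f'.
Proof.
(* One cell for each allowed degree and each map to [X]: this is where coproducts indexed by Hom
   sets are taken. *)
pose I : small := {i : {i | S i} & hom_small (hom (sh G (sval i)) X)}.
have [Z [inj cp]] := coprods (fun l : I => sh G (sval (projT1 l))).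
have [u uE] := coproduct_map (fun l : I => projT2 l) cp.
have PZ : P Z.
  by apply: (@P_coproduct I (fun l => sval (projT1 l))) => [[[i Si] f] //|]; exists inj.
exists (ApproxStage u PZ) => i Si f; pose l : I := existT _ (exist _ i Si) f.
by exists (inj l); exact/esym/(uE l).
Qed.

(** Cone off all maps from shifts of [G] to [s] that die in [X]. Killing a map from [G[i]] attaches
    a cell [G[i + 1]], hence the condition on [i + 1]. *)
Lemma approx_step (s : approx_stage) : exists (s' : approx_stage) (t : hom s s'),
  stage_map s' \oc t = stage_map s /\
  forall i, S (i + 1) -> forall f : hom (sh G i) s, stage_map s \oc f = 0 -> t \oc f = 0.
Proof.
pose I : small := {i : {i | S (i + 1)} &
  {f : hom_small (hom (sh G (sval i)) s) | stage_map s \oc f = 0}}.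
have [Z [inj cp]] := coprods (fun l : I => sh G (sval (projT1 l))).
have [u uE] := coproduct_map (fun l : I => sval (projT2 l)) cp.
have [A' [t [h tr]]] := TR1_cone u.
have [|a aE] := triangle_exactr (y := stage_map s) tr.
  apply: (coproduct_ext cp) => -[i [f f0]].
  by rewrite -compA uE /= f0 comp0l.
have PA : P A'.
  apply: (@P_ext s A' (sh Z 1)); first by exists t, h, (- fmap (shift T) u); apply/triangle_rot.
    exact: stage_in.
  apply: (@P_coproduct I (fun l => sval (projT1 l) + 1)) => [[[i Si] f] //|].
  apply: (@coproduct_of_iso _ I (fun l => sh (sh G (sval (projT1 l))) 1)).
  - by move=> l; exact: sh_add.
  - exact: isomorphic_refl.
  - by apply: coproduct_of_sh; exists inj.
exists (ApproxStage a PA), t; split=> // i Si f f0.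
pose l : I := existT _ (exist _ i Si) (exist _ f f0).
by have := uE l => /= <-; rewrite compA (triangle_comp tr) comp0l.
Qed.

(** A map from [G[i]] to the cone [C] has a boundary [G[i - 1] -> H] that lifts to a finite stage
    and dies in [X], so it dies at the next stage. The map therefore comes from [X]; there it
    factors through stage 0, and its image in [C] is zero. *)
Lemma approximation : exists (A : nat -> T) (t : forall n, hom (A n) (A n.+1)) H
    (e : forall n, hom (A n) H) (w : hom H X) C (g : hom X C) (h : hom C (shift T H)),
  [/\ forall n, P (A n), is_hocolim t e, triangle w g h
    & forall i, S i -> orth (sh G i) C].
Proof.
have [s0 s0P] := approx_stage0.
have [next /dep_choice [t tP]] := dep_choice approx_step.
pose s n := iter n next s0.
pose ts n : hom (s n) (s n.+1) := t (s n).
have [H [e hc]] := hocolim_ex ts.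
have [w wE] : exists w : hom H X, forall n, w \oc e n = stage_map (s n).
  by apply: (hocolim_map hc) => n; exact: (tP (s n)).1.
have [C [g [h tr]]] := TR1_cone w.
exists s, ts, H, e, w, C, g, h; split=> // [n|i Si]; first exact: stage_in.
suff : orth (shift T (sh G (i - 1))) C.
  by apply: orth_isol; have := sh_succ G (i - 1); rewrite subrK => /isomorphic_sym.
move=> f; have [y yE] := functor_full (shift_unshift T) (h \oc f).
have hf : h \oc f = 0.
  have wy : w \oc y = 0.
    apply: (functor_faithful (shift_unshift T)); rewrite raddf0 fmap_comp yE compA.
    have := triangle_comp (triangle_rot (triangle_rot tr)).
    by rewrite compNl => /eqP; rewrite oppr_eq0 => /eqP ->; rewrite comp0l.
  have [n [z zE]] := hocolim_lift hc (@fincompact_sh _ G (i - 1) G_compact) y.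
  have tz : ts n \oc z = 0.
    by apply: (tP (s n)).2; [rewrite subrK | rewrite -wE -compA -zE].
  by rewrite -yE zE -(hocolim_comp hc) -compA tz comp0r raddf0.
have [x ->] := triangle_exactl (triangle_rot tr) hf.
have [b [b' [b'b bb']]] := sh_succ G (i - 1); move: (b) (b') b'b bb'.
rewrite subrK => {b b'} b b' b'b bb'.
have [x' x'E] := s0P i Si (x \oc b).
have xE : x = w \oc (e 0%N \oc x' \oc b').
  by rewrite !compA wE -x'E -compA bb' comp_idr.
by rewrite xE compA (triangle_comp tr) comp0l.
Qed.

End Approximation.
End Hocolim.

(** * Standard truncations and change of generator *)

Section StandardTStructure.
Variable T : triangulated.
Implicit Types X Y Z W K G : T.

(** The two halves of the t-structure generated by [G], in degree [n] and without shifting the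
    object; [le_partE] and [ge_partE] give the agreement with the shifted forms. *)
Definition gen_le G (n : int) : T -> Prop := generated G `]-oo, n].
Definition gen_ge G (n : int) X : Prop := forall i : int, 1 - n <= i -> orth (sh G i) X.

Lemma gen_le_mono G n m X : n <= m -> gen_le G n X -> gen_le G m X.
Proof. by move=> nm; apply: gen_mono => i; rewrite !in_itv /=; lia. Qed.

Lemma gen_ge_mono G n m X : m <= n -> gen_ge G n X -> gen_ge G m X.
Proof. by move=> nm o i im; apply: o; lia. Qed.

Lemma gen_le_sh G n k X : gen_le G n X -> gen_le G (n - k) (sh X k).
Proof. by apply: gen_sh => i; rewrite !in_itv /=; lia. Qed.

Lemma gen_ge_sh G n k X : gen_ge G n X -> gen_ge G (n - k) (sh X k).
Proof.
move=> o i im; have e : i - k + (k - i) = 0 by lia.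
by apply/(orth_shift G X (erefl (k - i)))/(orth_shl G X e)/o; lia.
Qed.

Lemma gen_le_iso G n X Y : isomorphic X Y -> gen_le G n X -> gen_le G n Y.
Proof. exact: gen_iso. Qed.

Lemma gen_ge_iso G n X Y : isomorphic X Y -> gen_ge G n X -> gen_ge G n Y.
Proof. by move=> i o k /o; exact: orth_isor. Qed.

Lemma le_partE G n X : le_part (gen_le0 G) n X <-> gen_le G n X.
Proof.
split=> [[Y [lY i]]|lX].
  apply: gen_le_iso (isomorphic_sym i) _.
  by have := gen_le_sh (- n) lY; rewrite sub0r opprK.
exists (sh X n); split; first by have := gen_le_sh n lX; rewrite subrr.
by apply/isomorphic_sym/sh_opp; rewrite subrr.
Qed.

Lemma gen_ge1E G X : gen_ge1 G X <-> gen_ge G 1 X.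
Proof. by split=> o i h; apply: o; lia. Qed.

Lemma ge_partE G n X : ge_part (gen_ge1 G) n X <-> gen_ge G n X.
Proof.
split=> [[Y [/gen_ge1E lY i]]|lX].
  apply: gen_ge_iso (isomorphic_sym i) _.
  by have := gen_ge_sh (k := 1 - n) lY; rewrite (_ : 1 - (1 - n) = n) //; lia.
exists (sh X (n - 1)); split; last by apply/isomorphic_sym/sh_opp; lia.
by apply/gen_ge1E; have := gen_ge_sh (k := n - 1) lX; rewrite (_ : n - (n - 1) = 1) //; lia.
Qed.

Lemma gen_le_ge_orth G n m X Y : n < m -> gen_le G n X -> gen_ge G m Y -> orth X Y.
Proof.
by move=> nm lX gY; apply: gen_orthl lX => i; rewrite in_itv /= => h; apply: gY; lia.
Qed.

Lemma gen_le_ext G n X Z Y : extension X Z Y -> gen_le G n X -> gen_le G n Y -> gen_le G n Z.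
Proof. exact: gen_ext. Qed.

Lemma gen_ge_ext G n X Z Y : extension X Z Y -> gen_ge G n X -> gen_ge G n Y -> gen_ge G n Z.
Proof. by move=> e gX gY i h; apply: orth_extr e _ _; [exact: gX | exact: gY]. Qed.

Lemma gen_ge_coproduct G n (I : small) (F : I -> T) Z : fincompact G ->
  coproduct_of F Z -> (forall i, gen_ge G n (F i)) -> gen_ge G n Z.
Proof.
move=> cG cp gF i h; apply: orth_fincompact cp _; first exact: fincompact_sh.
by move=> j; exact: gF.
Qed.

Lemma TminusE G X : Tminus G X <-> exists n, gen_le G n X.
Proof. by split=> -[n h]; exists n; apply/le_partE. Qed.

Lemma TplusE G X : Tplus G X <-> exists n, gen_ge G n X.
Proof. by split=> -[n h]; [exists (- n) | exists (- n); rewrite opprK]; apply/ge_partE. Qed.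

Section CompactObjects.
Hypothesis coprods : has_small_coproducts T.

(** Approximation by the cells [G[i]] with [- n <= i]. The homotopy colimit stays in [gen_le G n],
    being an extension of [Z[1]] by a coproduct [Z] of stages. *)
Lemma gen_truncation G n X : fincompact G ->
  exists (A B : T) (f : hom A X) (g : hom X B) (h : hom B (shift T A)),
    [/\ triangle f g h, gen_le G n A & gen_ge G (n + 1) B].
Proof.
move=> cG.
have [||A [t [H [e [w [C [g [h [PA hc tr o]]]]]]]]] :=
  @approximation T coprods G X (fun i => - n <= i) (gen_le G n) cG.
- move=> I k Z kn cp; apply: gen_coproduct_of cp _ => i.
  by apply: gen_baseW (isomorphic_refl _) _; rewrite in_itv /=; have := kn i; lia.
- by move=> Z Z' Z'' e; exact: gen_le_ext e.
exists H, C, w, g, h; split=> //; last by move=> i h'; apply: o; lia.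
have [Z cp e'] := hocolim_ext hc.
have lZ : gen_le G n Z by exact: gen_coproduct_of cp PA.
apply: (gen_le_ext e' lZ).
by apply: (gen_le_mono _ (gen_le_sh 1 lZ)); lia.
Qed.

Lemma Tsb_mono G n m X : (n <= m)%N ->
  generated G `[- n%:Z, n%:Z] X -> generated G `[- m%:Z, m%:Z] X.
Proof. by move=> nm; apply: gen_mono => i; rewrite !in_itv /=; lia. Qed.

Lemma Tsb_itv G a b X : generated G `[a, b] X -> Tsb G X.
Proof.
move=> g; exists (`|a| + `|b|)%N; apply: gen_mono g => i; rewrite !in_itv /=; lia.
Qed.

Lemma Tsb_iso G X Y : isomorphic X Y -> Tsb G X -> Tsb G Y.
Proof. by move=> i [n h]; exists n; exact: gen_iso i h. Qed.

Lemma Tsb_retract G X Z (i : hom X Z) (p : hom Z X) :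
  p \oc i = idm X -> Tsb G Z -> Tsb G X.
Proof. by move=> pi [n h]; exists n; exact: gen_retract pi h. Qed.

Lemma Tsb_ext G X Z Y : extension X Z Y -> Tsb G X -> Tsb G Y -> Tsb G Z.
Proof.
move=> e [n hn] [m hm]; exists (maxn n m); apply: gen_ext e _ _.
  exact: Tsb_mono (leq_maxl _ _) hn.
exact: Tsb_mono (leq_maxr _ _) hm.
Qed.

Lemma Tsb_biproduct G X Z Y : is_biproduct X Y Z -> Tsb G X -> Tsb G Y -> Tsb G Z.
Proof.
move=> /biproduct_coproduct e [n hn] [m hm]; exists (maxn n m).
apply: gen_coproduct_of e _ => -[].
  exact: Tsb_mono (leq_maxl _ _) hn.
exact: Tsb_mono (leq_maxr _ _) hm.
Qed.

Lemma Tsb_sh G X k : Tsb G X -> Tsb G (sh X k).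
Proof.
move=> [n h]; apply: (@Tsb_itv _ (- n%:Z - k) (n%:Z - k)).
by apply: gen_sh h => i; rewrite !in_itv /=; lia.
Qed.

Lemma Tsb_base G k : Tsb G (sh G k).
Proof.
apply: (@Tsb_itv _ (- k) (- k)); apply: gen_baseW (isomorphic_refl _) _.
by rewrite in_itv /=; lia.
Qed.

(** The class of stages used in [fincompact_Tsb]. Stages are large coproducts, so only the maps from
    compact objects into them can be controlled by compact objects of [Tsb G]. *)
Definition factors_Tsb G X := forall K, fincompact K -> forall x : hom K X,
  exists L (v : hom L X) (u : hom K L), [/\ fincompact L, Tsb G L & x = v \oc u].

Lemma factor_add G K X (x x' : hom K X) L L' (v : hom L X) (u : hom K L)
    (v' : hom L' X) (u' : hom K L') :
  fincompact L -> fincompact L' -> Tsb G L -> Tsb G L' ->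
  x = v \oc u -> x' = v' \oc u' ->
  exists M (w : hom M X) (y : hom K M), [/\ fincompact M, Tsb G M & x + x' = w \oc y].
Proof.
move=> cL cL' sL sL' -> ->; have [M bM] := biproduct_ex L L'.
have [i [j [p [q [pi qj qi pj e]]]]] := bM.
exists M, (v \oc p + v' \oc q), (i \oc u + j \oc u'); split.
- exact: fincompact_biproduct bM cL cL'.
- exact: Tsb_biproduct bM sL sL'.
- rewrite compDr !compDl !compA -!(compA v) -!(compA v').
  by rewrite pi qj qi pj !comp_idl !comp0l !comp0r addr0 add0r.
Qed.

Lemma factors_Tsb_coproduct G (I : small) (k : I -> int) Z : fincompact G ->
  coproduct_of (fun i => sh G (k i)) Z -> factors_Tsb G Z.
Proof.
move=> cG [inj cp] K cK x; elim: (cK _ _ _ _ cp x) => [|i y {}x _ [L [v [u [cL sL e]]]]].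
  have [O zO] := zero_ex T; exists O, 0, 0; split; last by rewrite comp0l.
  - by move=> J F W inj' _ y; rewrite (is_zero_orthl zO y); exact: finsum0.
  - by exists 0%N; exact: gen_zero.
exact: (factor_add (fincompact_sh cG) cL (Tsb_base G (k i)) sL (erefl (inj i \oc y)) e).
Qed.

(* Given [x : K -> Z], factor [K -> Y] through [Y'], take the fibre [K'] of
   [K -> Y'] and factor [K' -> X] through [X']; an extension [P] of [Y'] by [X']
   carries a map [K -> P -> Z] agreeing with [x] in [Y], so the difference lifts
   to [X] and factors through a third object. *)
Lemma factors_Tsb_ext G X Z Y :
  extension X Z Y -> factors_Tsb G X -> factors_Tsb G Y -> factors_Tsb G Z.
Proof.
move=> [f [g [h t]]] qX qY K cK x.
have [Y' [v [u [cY' sY' vu]]]] := qY K cK (g \oc x).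
have [K' [i [j tK]]] : exists (K' : T) (i : hom K' K) (j : hom Y' (shift T K')), triangle i u j.
  have [W [a [b tW]]] := TR1_cone u.
  by have [i [j [_ [tK _ _ _]]]] := triangle_rotV tW; exists (unshift T W), i, j.
have [a [ai aj]] := TR3_left tK t vu.
have cK' : fincompact K'.
  apply: (@fincompact_extension _ (sh Y' (-1)) K' K) cK.
    by apply: extension_rotV; exists i, u, j.
  exact: fincompact_sh.
have [X' [v' [u' [cX' sX' aE]]]] := qX K' cK' a.
have [P [p [q tP]]] := triangle_from (fmap (shift T) u' \oc j).
have [|y [yi qy]] := TR3_mid (a := u') (c := idm Y') tK tP; first by rewrite comp_idr.
have [|z [zp gz]] := TR3_mid (a := v') (c := v) tP t.
  by rewrite compA -fmap_comp -aE.
have [|e eE] := triangle_exactl (x := x - z \oc y) t.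
  by rewrite compBr compA gz -compA qy comp_idl -vu subrr.
have [X'' [v'' [u'' [cX'' sX'' e''E]]]] := qX K cK e.
have eP : extension X' P Y' by exists p, q, (fmap (shift T) u' \oc j).
rewrite -(subrK (z \oc y) x) addrC.
apply: (@factor_add G K Z (z \oc y) (x - z \oc y) P X'' z y (f \oc v'') u'') => //.
- exact: fincompact_extension eP _ _.
- exact: Tsb_ext eP _ _.
- by rewrite eE e''E compA.
Qed.

(** Approximating [K] with all shifts of [G] leaves a zero cone, so [K] is a homotopy colimit of
    stages. Its identity lifts to a finite stage and factors there through some [L], making [K] a
    retract of [L]. *)
Lemma fincompact_Tsb G K : compact_generator G -> fincompact K -> Tsb G K.
Proof.
move=> gG cK; have cG := compact_fincompact gG.1.
have [||A [t [H [e [w [C [g [h [PA hc tr o]]]]]]]]] :=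
  @approximation T coprods G K (fun _ => True) (factors_Tsb G) cG.
- by move=> I k Z _; exact: factors_Tsb_coproduct.
- by move=> Z Z' Z''; exact: factors_Tsb_ext.
have zC : is_zero C by apply: (gen_zero_crit gG) => i; exact: o.
have [w' [w'w ww']] := cone_zero tr zC.
have [n [y yE]] := hocolim_lift hc cK w'.
have [L [v [u [cL sL vu]]]] := PA n K cK y.
apply: (Tsb_retract (i := u) (p := w \oc e n \oc v)) sL.
by rewrite -!compA -vu -yE.
Qed.

Lemma generator_Tsb G K : compact_generator G -> compact_generator K -> Tsb G K.
Proof. by move=> gG [/compact_fincompact cK _]; exact: fincompact_Tsb. Qed.

Lemma generator_le G K : compact_generator G -> compact_generator K ->
  exists2 c : int, 0 <= c & forall n X, gen_le K n X -> gen_le G (n + c) X.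
Proof.
move=> gG gK; have [n h] := generator_Tsb gG gK; exists n%:Z => // m X.
apply: gen_trans => i; rewrite in_itv /= => im.
apply: gen_sh h => j; rewrite !in_itv /=; lia.
Qed.

Lemma generator_ge G K : compact_generator G -> compact_generator K ->
  exists2 c : int, 0 <= c & forall n X, gen_ge G n X -> gen_ge K (n - c) X.
Proof.
move=> gG gK; have [c c0 h] := generator_le gG gK; exists c => // n X gX i im.
apply: (@gen_le_ge_orth G (- i + c) n) gX; first by lia.
apply: h; apply: gen_baseW (isomorphic_refl _) _; rewrite in_itv /=; lia.
Qed.

Lemma Tsb_generator G K : compact_generator G -> compact_generator K ->
  subcat_le (Tsb K) (Tsb G).
Proof.
move=> gG gK X [n h]; have [m hm] := generator_Tsb gG gK.
apply: (@Tsb_itv _ (- n%:Z - m%:Z) (n%:Z + m%:Z)); apply: gen_trans h => i.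
by rewrite in_itv /= => im; apply: gen_sh hm => j; rewrite !in_itv /=; lia.
Qed.

Lemma Tminus_generator G K : compact_generator G -> compact_generator K ->
  subcat_le (Tminus K) (Tminus G).
Proof.
move=> gG gK X /TminusE [n h]; have [c _ hc] := generator_le gG gK.
by apply/TminusE; exists (n + c); exact: hc.
Qed.

Lemma Tplus_generator G K : compact_generator G -> compact_generator K ->
  subcat_le (Tplus K) (Tplus G).
Proof.
move=> gG gK X /TplusE [n h]; have [c _ hc] := generator_ge gK gG.
by apply/TplusE; exists (n - c); exact: hc.
Qed.

Lemma Tsb_minus G : subcat_le (Tsb G) (Tminus G).
Proof.
move=> X [n h]; apply/TminusE; exists n%:Z; apply: gen_mono h => i.
by rewrite !in_itv /=; lia.
Qed.

Lemma Tsb_plus G : fincompact G -> bounded_object G -> subcat_le (Tsb G) (Tplus G).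
Proof.
move=> cG [N o] X [n h]; apply/TplusE; exists (1 - n%:Z + N) => i im.
apply: gen_orthr h; first exact: fincompact_sh.
move=> j; rewrite in_itv /= => jn.
by apply/(orth_shift G G (erefl (- j - i))); apply: o; lia.
Qed.

Lemma Tsb_Tb G G0 : compact_generator G -> compact_generator G0 ->
  bounded_object G0 -> subcat_le (Tsb G) (Tb G).
Proof.
move=> gG gG0 bG0 X sX; split; first exact: Tsb_minus.
apply: (Tplus_generator gG gG0); apply: Tsb_plus => //.
  exact: compact_fincompact gG0.1.
exact: Tsb_generator gG0 gG _ _.
Qed.

End CompactObjects.
End StandardTStructure.

(** * Bounded t-structures and weak approximability *)

Section TStructures.
Variable T : triangulated.
Implicit Types X Y Z W K G : T.

Section General.
Variables (C : T -> Prop) (t : t_structure C).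

Lemma t_orthP X Y : tle0 t X -> tge1 t Y -> orth X Y.
Proof. exact: t_orth. Qed.

Lemma tle0_sh X k : 0 <= k -> tle0 t X -> tle0 t (sh X k).
Proof.
case: k => // k _ lX; elim: k => // k IH.
by apply: tle0_shift; exists (sh X k); split=> //; exact: isomorphic_refl.
Qed.

Lemma tge1_sh X k : k <= 0 -> tge1 t X -> tge1 t (sh X k).
Proof.
move=> k0 gX; rewrite (_ : k = - `|k|%N%:Z); last by lia.
elim: `|k|%N => // n /tge1_shift [Y [gY i]].
apply: tge1_iso gY.
have i' := sh_isomorphic (- 1) i.
apply: isomorphic_trans (isomorphic_sym _) (isomorphic_trans (isomorphic_sym i') _).
- by apply: sh_opp.
- by apply: sh_eqadd; lia.
Qed.

Lemma t_leE n X : t_le t n X <-> tle0 t (sh X n).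
Proof.
split=> [[Y [lY i]]|lX].
  apply: tle0_iso lY; apply: isomorphic_sym.
  by apply: isomorphic_trans (sh_isomorphic n i) (sh_opp _ _); rewrite addNr.
by exists (sh X n); split=> //; apply/isomorphic_sym/sh_opp; rewrite subrr.
Qed.

Lemma t_geE n X : t_ge t n X <-> tge1 t (sh X (n - 1)).
Proof.
split=> [[Y [lY i]]|lX].
  apply: tge1_iso lY; apply: isomorphic_sym.
  by apply: isomorphic_trans (sh_isomorphic (n - 1) i) (sh_opp _ _); lia.
by exists (sh X (n - 1)); split=> //; apply/isomorphic_sym/sh_opp; lia.
Qed.

Lemma t_orth_shift A X : tle0 t A -> tge1 t X -> orth (shift T A) X.
Proof. by move=> lA gX; exact: (@t_orthP (sh A 1) _ (tle0_sh _ lA) gX). Qed.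

(** The truncation map [X -> B] vanishes by hypothesis, so [A -> X] is an isomorphism. *)
Lemma tle0_crit X : C X -> (forall Y, tge1 t Y -> orth X Y) -> tle0 t X.
Proof.
move=> /(t_trunc t) [A [B [f [g [h [tr lA gB]]]]]] o.
have fi := cone_of_iso tr (t_orth_shift lA gB) (o B gB g).
by apply: tle0_iso lA; exists f.
Qed.

Lemma tge1_crit X : C X -> (forall Y, tle0 t Y -> orth Y X) -> tge1 t X.
Proof.
move=> /(t_trunc t) [A [B [f [g [h [tr lA gB]]]]]] o.
have gi := fiber_zero_iso tr (t_orth_shift lA gB) (o A lA f).
by apply: tge1_iso gB; apply: isomorphic_sym; exists g.
Qed.

Lemma tle0_ext X Z Y : C Z -> extension X Z Y -> tle0 t X -> tle0 t Y -> tle0 t Z.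
Proof.
move=> cZ e lX lY; apply: tle0_crit => // W gW.
exact: (orth_extl e (t_orthP lX gW) (t_orthP lY gW)).
Qed.

Lemma tge1_ext X Z Y : C Z -> extension X Z Y -> tge1 t X -> tge1 t Y -> tge1 t Z.
Proof.
move=> cZ e lX lY; apply: tge1_crit => // W lW.
exact: (orth_extr e (t_orthP lW lX) (t_orthP lW lY)).
Qed.

End General.

Section Subcategory.
Variables (C : T -> Prop) (fC : full_triangulated_subcategory C).

Lemma fts_sh X n : C X -> C (sh X n).
Proof.
move=> cX; elim/int_ind: n => [//|n IH|n IH].
  rewrite -addn1 PoszD.
  by apply: (fts_iso fC) (fts_shift fC IH); apply: sh_add.
rewrite -addn1 PoszD opprD.
by apply: (fts_iso fC) (fts_unshift fC IH); apply: sh_add.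
Qed.

Lemma fts_shE X n : C (sh X n) -> C X.
Proof.
move=> /(@fts_sh _ (- n)); apply: (fts_iso fC); apply: sh_opp.
by rewrite subrr.
Qed.

Lemma fts_right X Z Y : extension X Z Y -> C X -> C Z -> C Y.
Proof. by move=> [f [g [h t]]]; exact: fts_cone t. Qed.

(** Truncation in degree [n]; the final orthogonality is the input for uniqueness in
    [extension_orth_unique]. *)
Lemma t_trunc_sh (t : t_structure C) X n : C X ->
  exists A B, [/\ extension A X B, tle0 t (sh A n), tge1 t (sh B n) & orth (sh A 1) B].
Proof.
move=> /(@fts_sh _ n)/(t_trunc t) [A [B [f [g [h [tr lA gB]]]]]].
exists (sh A (- n)), (sh B (- n)); split.
- have : extension A (sh X n) B by exists f, g, h.
  move=> /(extension_sh (- n)); apply: extension_iso; try exact: isomorphic_refl.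
  by apply: sh_opp; rewrite subrr.
- by apply: tle0_iso lA; apply/isomorphic_sym/sh_opp; rewrite addNr.
- by apply: tge1_iso gB; apply/isomorphic_sym/sh_opp; rewrite addNr.
- have := t_orth_shift lA gB; move/(orth_sh _ _ (- n)).
  apply: orth_isol; apply: isomorphic_trans (sh_add A 1 (- n)) _.
  by rewrite addrC; apply/isomorphic_sym/sh_add.
Qed.

End Subcategory.

(** The octahedral axiom for [X -> D -> D']: the fibre of the composite is an extension of the two
    fibres. *)
Lemma octahedron E X D E' D' : extension E X D -> extension E' D D' ->
  exists2 E'', extension E'' X D' & extension E E'' E'.
Proof.
move=> /extension_rot [f [u1 [v1 t1]]] /extension_rot [g [u2 [v2 t2]]].
have [Y [u3 [v3 t3]]] := TR1_cone (g \oc f).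
have [a [b [t4 _]]] := TR4 t1 t2 t3.
exists (sh Y (- 1)).
  by apply: extension_rotV; exists (g \oc f), u3, v3.
have : extension (sh E 1) Y (sh E' 1) by exists a, b, (fmap (shift T) u1 \oc v2).
move=> /(extension_sh (- 1)); apply: extension_iso; try exact: isomorphic_refl.
  exact: sh_opp.
exact: sh_opp.
Qed.

Lemma gen_le_of_trunc G n X A B (f : hom A X) (g : hom X B) h :
  triangle f g h -> gen_le G n A -> gen_ge G (n + 1) B -> g = 0 -> gen_le G n X.
Proof.
move=> tr lA gB g0; apply: gen_le_iso (lA); exists f.
apply: (cone_of_iso tr) g0.
by apply: gen_le_ge_orth (gen_le_sh 1 lA) gB; lia.
Qed.

(** * The t-structure of weak approximability compared with the generated one *)

Section WeakApproximation.
Hypothesis coprods : has_small_coproducts T.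
Variables (G : T) (t : t_structure (fun _ : T => True)) (A : int).
Hypothesis gG : compact_generator G.
Hypothesis A_gt0 : 0 < A.
Hypothesis GA : tle0 t (sh G A).
Hypothesis GA_orth : forall F, tle0 t F -> orth (sh G (- A)) F.
Hypothesis approxF : forall F, tle0 t F ->
  exists (E D : T) (f : hom E F) (g : hom F D) (h : hom D (shift T E)),
    [/\ triangle f g h, generated G `[- A, A] E & t_le t (-1) D].

(** The approximation of [F[-n]], shifted back by [n]. This moves [E] only to lower degrees, so the
    bound [A] is uniform in [n]. *)
Lemma approx_sh (n : nat) F : tle0 t (sh F (- n%:Z)) ->
  exists E D, [/\ extension E F D, Tsb G E, gen_le G A E & tle0 t (sh D (- n.+1%:Z))].
Proof.
move=> /approxF [E [D [f [g [h [tr gE /t_leE lD]]]]]].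
exists (sh E n), (sh D n); split.
- have : extension E (sh F (- n%:Z)) D by exists f, g, h.
  move=> /(extension_sh n); apply: extension_iso; try exact: isomorphic_refl.
  by apply: sh_opp; rewrite addNr.
- exact/Tsb_sh/Tsb_itv/gE.
- by apply: gen_sh gE => i; rewrite !in_itv /=; lia.
- by apply: tle0_iso lD; apply/isomorphic_sym/sh_eqadd; lia.
Qed.

(** Successive approximations are spliced by the octahedron, each step lowering the remainder by one
    degree. *)
Lemma approx_tle0 (n : nat) F : tle0 t F ->
  exists E D, [/\ extension E F D, Tsb G E & tle0 t (sh D (- n%:Z))].
Proof.
elim: n => [|n IH] lF.
  have [O zO] := zero_ex T; exists O, F; split=> //; last first.
    by exists 0%N; exact: gen_zero.
  apply: (@extension_iso _ (sh O (- 1)) F F); try exact: isomorphic_refl.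
    by apply: is_zero_isomorphic => //; apply/is_zero_sh.
  by apply: extension_rotV; exists (idm F), 0, 0; exact: TR1_id.
have [E [D [eF sE lD]]] := IH lF.
have [E' [D' [eD sE' _ lD']]] := approx_sh lD.
have [E'' eF' eE''] := octahedron eF eD.
by exists E'', D'; split=> //; exact: Tsb_ext eE'' _ _.
Qed.

Lemma gen_le_tle0 X : gen_le G (- A) X -> tle0 t X.
Proof.
move=> lX; apply: tle0_crit => // Y gY; apply: gen_orthl lX => i.
rewrite in_itv /= => iA; apply: (t_orthP _ gY).
apply: (@tle0_iso _ _ t (sh (sh G A) (- i - A))); first by apply: sh_eqadd; lia.
by apply: tle0_sh => //; lia.
Qed.

(* A map from [F] to an object of [gen_ge G (A + 1)] factors through a sequence
   [D_n] with [D_n] in [t_le t (- n)], hence through its homotopy colimit, on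
   which all [Hom(G[i], -)] vanish. *)
Lemma tle0_gen_le X : tle0 t X -> gen_le G A X.
Proof.
move=> lX; have cG := compact_fincompact gG.1.
have [B [Y [f [g [h [tr lB gY]]]]]] := gen_truncation coprods A X cG.
apply: (gen_le_of_trunc tr lB gY).
(* A stage carries its index [n] together with [D] and the map to [Y], so that a single choice
   function iterates the construction. *)
pose stage := {s : nat * {D : T & hom D Y} | tle0 t (sh (projT1 s.2) (- s.1%:Z))}.
pose ob (s : stage) : T := projT1 (sval s).2.
pose mp (s : stage) : hom (ob s) Y := projT2 (sval s).2.
have step (s : stage) : exists s' : stage,
    exists2 d : hom (ob s) (ob s'), mp s' \oc d = mp s & (sval s').1 = (sval s).1.+1.
  case: s => -[n [D y]] /= lD.
  have [E [D' [[a [d [c tr']]] _ lE lD']]] := approx_sh lD.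
  (* Degree reasons make [y] vanish on [E], hence it extends over [D']. *)
  have [|y' yE] := triangle_exactr (y := y) tr'.
    by apply: (gen_le_ge_orth _ lE gY); lia.
  by exists (exist _ (n.+1, existT _ D' y') lD'), d.
have [next nextP] := dep_choice step.
have /dep_choice [d dP] : forall s, exists d : hom (ob s) (ob (next s)),
    mp (next s) \oc d = mp s /\ (sval (next s)).1 = (sval s).1.+1.
  by move=> s; have [d ? ?] := nextP s; exists d.
pose s0 : stage := exist _ (0%N, existT _ X g) lX.
pose s n := iter n next s0.
have s1 n : (sval (s n)).1 = n by elim: n => //= n IH; rewrite (dP (s n)).2 IH.
have [H [e hc]] := hocolim_ex coprods (A := fun n => ob (s n)) (fun n => d (s n)).
have [w wE] := hocolim_map hc (fun n => (dP (s n)).1).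
have zH : is_zero H.
  apply: (gen_zero_crit gG) => i.
  apply: (hocolim_orth hc); first exact: fincompact_sh.
  (* For this late index [m], the shift [D_m[-A-i]] is still in the aisle, and Hom(G[i], D_m) is
     Hom(G[-A], D_m[-A-i]). *)
  move=> n; exists (n + `|i| + `|A|)%N; first lia.
  set m := (n + _ + _)%N; have := svalP (s m); rewrite s1 -/(ob (s m)) => lm.
  apply/(@orth_shl _ _ _ i (- i)); first by rewrite subrr.
  have k0 : 0 <= - A - i + m%:Z by lia.
  have eA : - A - i + m%:Z - - A = m%:Z - i by lia.
  have := GA_orth (tle0_sh k0 lm); move/(orth_shift _ _ eA).
  by apply: orth_isor; apply: sh_eqadd; lia.
by rewrite -[g]/(mp (s 0%N)) -wE (is_zero_orthl zH w) comp0l.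
Qed.

End WeakApproximation.
End TStructures.

(** * Bounded objects, their standard t-structure and its comparison with others *)

Section BoundedTStructures.
Variable T : triangulated.
Hypothesis coprods : has_small_coproducts T.
Implicit Types X Y Z W K G : T.

(** Extends the approximation to any generator, any object of [Tminus G] and any depth [n]: shift
    [X] into the aisle, approximate, shift back. *)
Lemma weak_approximation G X n : weakly_approximable T -> compact_generator G ->
  Tminus G X -> exists E D, [/\ extension E X D, Tsb G E & gen_le G n D].
Proof.
move=> [K [t [A [gK A0 KA KAo apx]]]] gG mX.
have [c c0 hc] := generator_le coprods gG gK.
have /TminusE [k lX] := Tminus_generator coprods gK gG mX.
have lX' : tle0 t (sh X (k + A)).
  apply: (gen_le_tle0 A0 KA); have := gen_le_sh (k + A) lX.
  by rewrite (_ : k - (k + A) = - A) //; lia.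
(* The remainder lies in degrees at most [A - N] for [K]; shifting back adds [k + A], changing
   generator adds [c], and the total must not exceed [n]. *)
pose N := absz (A + (k + A) + c - n)%R.
have [E [D [eX sE lD]]] := approx_tle0 A0 apx N lX'.
have {}lD := gen_le_sh N (tle0_gen_le coprods gK A0 KAo apx lD).
exists (sh E (- (k + A))), (sh D (- (k + A))); split.
- have := extension_sh (- (k + A)) eX.
  apply: extension_iso; try exact: isomorphic_refl.
  by apply: sh_opp; rewrite subrr.
- exact/Tsb_sh/(Tsb_generator coprods gG gK).
- have {}lD : gen_le K (A - N%:Z) D.
    by apply: gen_le_iso lD; apply: sh_opp; rewrite addNr.
  apply: (@gen_le_mono _ _ (A - N%:Z - - (k + A) + c)); first by rewrite /N; lia.
  exact/hc/gen_le_sh.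
Qed.

Lemma gen_ge_left G n A X B : extension A X B -> gen_ge G n X -> gen_ge G (n - 1) B ->
  gen_ge G n A.
Proof.
move=> e gX gB; apply: (gen_ge_ext (extension_rotV e) _ gX).
by have := gen_ge_sh (k := - 1) gB; rewrite (_ : n - 1 - - 1 = n) //; lia.
Qed.

Lemma Tminus_ext G X Z Y : extension X Z Y -> Tminus G X -> Tminus G Y -> Tminus G Z.
Proof.
move=> e /TminusE [n hn] /TminusE [m hm]; apply/TminusE.
exists (Num.max n m); apply: (gen_le_ext e).
  by apply: gen_le_mono hn; rewrite le_max lexx.
by apply: gen_le_mono hm; rewrite le_max lexx orbT.
Qed.

Lemma Tplus_ext G X Z Y : extension X Z Y -> Tplus G X -> Tplus G Y -> Tplus G Z.
Proof.
move=> e /TplusE [n hn] /TplusE [m hm]; apply/TplusE.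
exists (Num.min n m); apply: (gen_ge_ext e).
  by apply: gen_ge_mono hn; rewrite ge_min lexx.
by apply: gen_ge_mono hm; rewrite ge_min lexx orbT.
Qed.

Lemma Tminus_sh G X k : Tminus G X -> Tminus G (sh X k).
Proof. by move=> /TminusE [n h]; apply/TminusE; exists (n - k); exact: gen_le_sh. Qed.

Lemma Tplus_sh G X k : Tplus G X -> Tplus G (sh X k).
Proof. by move=> /TplusE [n h]; apply/TplusE; exists (n - k); exact: gen_ge_sh. Qed.

Lemma Tb_sh G X k : Tb G X -> Tb G (sh X k).
Proof. by move=> [m p]; split; [exact: Tminus_sh | exact: Tplus_sh]. Qed.

Lemma Tb_fts G : full_triangulated_subcategory (Tb G).
Proof.
split.
- move=> X Y i [/TminusE[n h] /TplusE[m k]].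
  by split; [apply/TminusE; exists n; exact: gen_le_iso i h
    | apply/TplusE; exists m; exact: gen_ge_iso i k].
- move=> Z zZ; split; first by apply/TminusE; exists 0; exact: gen_zero.
  by apply/TplusE; exists 0 => i _; exact: is_zero_orthr.
- by move=> X; exact: Tb_sh.
- by move=> X; exact: Tb_sh.
- move=> X Y Z f g h t bX bY; have [mX pX] := Tb_sh 1 bX.
  have e : extension Y Z (sh X 1) by exists g, h, (- fmap (shift T) f); exact: triangle_rot.
  by split; [exact: Tminus_ext e bY.1 mX | exact: Tplus_ext e bY.2 pX].
Qed.

Lemma Tsb_fts G : full_triangulated_subcategory (Tsb G).
Proof.
split.
- by move=> X Y; exact: Tsb_iso.
- by move=> Z zZ; exists 0%N; exact: gen_zero.
- by move=> X; exact: Tsb_sh.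
- by move=> X; exact: Tsb_sh.
- move=> X Y Z f g h t sX sY.
  apply: (@Tsb_ext _ _ Y Z (sh X 1)) => //; last exact: Tsb_sh.
  by exists g, h, (- fmap (shift T) f); exact: triangle_rot.
Qed.

Lemma Tb_trunc G n X A B : extension A X B -> gen_le G n A -> gen_ge G (n + 1) B ->
  Tb G X -> Tb G A /\ Tb G B.
Proof.
move=> e lA gB bX; suff bA : Tb G A by split=> //; exact: (fts_right (Tb_fts G) e bA bX).
split; first by apply/TminusE; exists n.
apply: (Tplus_ext (extension_rotV e)); last exact: bX.2.
by apply: Tplus_sh; apply/TplusE; exists (n + 1).
Qed.

(** Kept transparent: later proofs unfold its aisle and coaisle. *)
Definition standard_t_structure G : fincompact G -> t_structure (Tb G).
Proof.
move=> cG; refine (@TStructure T (Tb G) (fun X => gen_le G 0 X /\ Tb G X)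
  (fun X => gen_ge G 1 X /\ Tb G X) _ _ _ _ _ _ _ _).
- by move=> X Y i [lX bX]; split; [exact: gen_le_iso i lX | exact: (fts_iso (Tb_fts G) i bX)].
- by move=> X Y i [gX bX]; split; [exact: gen_ge_iso i gX | exact: (fts_iso (Tb_fts G) i bX)].
- by move=> X [].
- by move=> X [].
- move=> X [Y [[lY bY] /isomorphic_sym i]]; split; last first.
    by apply: (fts_iso (Tb_fts G) i); exact: Tb_sh.
  by apply: gen_le_iso i _; apply: (gen_le_mono _ (gen_le_sh 1 lY)).
- move=> X [gX bX]; exists (sh X (- 1)); split; last by apply/isomorphic_sym/sh_opp.
  by split; [apply: (gen_ge_mono _ (gen_ge_sh (k := - 1) gX)) | exact: Tb_sh].
- by move=> X Y [lX _] [gY _]; exact: (gen_le_ge_orth _ lX gY).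
- move=> X bX; have [A [B [f [g [h [tr lA gB]]]]]] := gen_truncation coprods 0 X cG.
  have [bA bB] : Tb G A /\ Tb G B.
    by apply: (Tb_trunc _ lA gB bX); exists f, g, h.
  by exists A, B, f, g, h.
Defined.

Lemma t_le_sub C (t : t_structure C) n X :
  full_triangulated_subcategory C -> t_le t n X -> C X.
Proof. by move=> fC /t_leE /tle0_sub; exact: fts_shE. Qed.

Lemma t_ge_sub C (t : t_structure C) n X :
  full_triangulated_subcategory C -> t_ge t n X -> C X.
Proof. by move=> fC /t_geE /tge1_sub; exact: fts_shE. Qed.

Lemma standard_bounded G (cG : fincompact G) : t_bounded (standard_t_structure cG).
Proof.
split=> X; split=> [bX|[m [_]]]; [|exact: t_le_sub (Tb_fts G)| |exact: t_ge_sub (Tb_fts G)].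
- have /TminusE [n lX] := bX.1; exists (absz n).+1; split=> //; apply/t_leE; split.
    by apply: (gen_le_mono _ (gen_le_sh _ lX)); lia.
  exact: Tb_sh.
- have /TplusE [n lX] := bX.2; exists (absz n).+1; split=> //; apply/t_geE; split.
    by apply: (gen_ge_mono _ (gen_ge_sh lX)); lia.
  exact: Tb_sh.
Qed.

Section Comparison.
Variables (G : T) (C : T -> Prop) (t : t_structure C).
Hypotheses (CG : C G) (bt : t_bounded t).

Lemma t_bounded_le X : C X -> exists m : nat, tle0 t (sh X m).
Proof. by move=> /(bt.1 X) [m [_ /t_leE]]; exists m. Qed.

Lemma t_bounded_ge X : C X -> exists m : nat, tge1 t (sh X (- m%:Z)).
Proof.
move=> /(bt.2 X) [m [_ /t_geE h]]; exists m.+1.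
by rewrite (_ : - m.+1%:Z = - m%:Z - 1) //; lia.
Qed.

(** Boundedness puts some [G[p]] in the aisle, hence every [G[i]] with [p <= i], and these are
    orthogonal to the coaisle. *)
Lemma tge1_gen_ge : exists p : nat, forall Y, tge1 t Y -> gen_ge G (1 - p%:Z) Y.
Proof.
have [p lG] := t_bounded_le CG; exists p => Y gY i ip.
have ip' : 0 <= i - p%:Z by lia.
apply: (t_orthP _ gY); apply: tle0_iso (tle0_sh ip' lG).
by apply: sh_eqadd; lia.
Qed.

Lemma gen_le_tle0_of : exists p : nat, forall X, C X -> gen_le G (- p%:Z) X -> tle0 t X.
Proof.
have [p gp] := tge1_gen_ge; exists p => X cX lX; apply: tle0_crit => // Y gY.
by apply: (gen_le_ge_orth _ lX (gp Y gY)); lia.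
Qed.

End Comparison.

(** * Uniqueness of the bounded t-structure up to equivalence *)

Section Uniqueness.
Variables (G : T) (t : t_structure (Tb G)).
Hypotheses (gG : compact_generator G) (bt : t_bounded t).
Let cG := compact_fincompact gG.1.
Let fC := Tb_fts G.

Lemma tge1_retract X Z (i : hom X Z) (p : hom Z X) k : p \oc i = idm X ->
  Tb G X -> tge1 t (sh Z k) -> tge1 t (sh X k).
Proof.
move=> pi bX gZ; apply: tge1_crit => [|Y lY]; first exact: fts_sh.
have [j [q qj]] := summand_retract (direct_summand_sh k (retract_summand pi)).
exact: (orth_retractr qj (t_orthP lY gZ)).
Qed.

(* If no [M] worked, a coproduct of counterexamples would lie in [Tb G] without
   being bounded below for [t]. *)
Lemma heart_tge1 : exists M : nat, forall X,
  gen_le G 0 X -> gen_ge G 0 X -> tge1 t (sh X (- M%:Z)).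
Proof.
apply: contrapT => /forallNP no.
have /dep_choice [X XP] : forall M : nat, exists X,
    [/\ gen_le G 0 X, gen_ge G 0 X & ~ tge1 t (sh X (- M%:Z))].
  by move=> M; apply: contrapT => /forallNP h; apply: (no M) => X lX gX;
    apply: contrapT => ntX; apply: (h X).
have [Z [inj cp]] := coprods X.
have bT Y : gen_le G 0 Y -> gen_ge G 0 Y -> Tb G Y.
  by move=> lY gY; split; [apply/TminusE | apply/TplusE]; exists 0.
have cpX : coproduct_of X Z by exists inj.
have bZ : Tb G Z.
  apply: bT; first by apply: gen_coproduct_of cpX _ => M; case: (XP M).
  by apply: gen_ge_coproduct cpX _ => // M; case: (XP M).
have [M gZ] := t_bounded_ge bt bZ.
have [lX gX] := XP M; apply.
have [p [pi _]] := coproduct_proj M cp.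
exact: (tge1_retract pi (bT _ lX gX) gZ).
Qed.

(** Induction on the amplitude. Truncation at 0 splits [X] into [A] in the heart and [B] in degrees
    1 to [k + 1]; induction applies to [B[1]], so the same [M] serves throughout. *)
Lemma gen_ge_tge1 : exists M : nat, forall (k : nat) X,
  gen_le G k X -> gen_ge G 0 X -> tge1 t (sh X (- M%:Z)).
Proof.
have [M hM] := heart_tge1; exists M; elim=> [|k IH] X lX gX; first exact: hM.
have bX : Tb G X by split; [apply/TminusE; exists k.+1 | apply/TplusE; exists 0].
have [A [B [f [g [h [tr lA gB]]]]]] := gen_truncation coprods 0 X cG.
have e : extension A X B by exists f, g, h.
have gA : gen_ge G 0 A by apply: (gen_ge_left e gX); apply: gen_ge_mono gB.
have lB : gen_le G k.+1 B.
  apply: (gen_le_ext (extension_rot e) lX).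
  by apply: (gen_le_mono _ (gen_le_sh 1 lA)); lia.
have tB : tge1 t (sh (sh B 1) (- M%:Z)).
  apply: IH; first by apply: (gen_le_mono _ (gen_le_sh 1 lB)); lia.
  by apply: (gen_ge_mono _ (gen_ge_sh (k := 1) gB)).
apply: (tge1_ext _ (extension_sh (- M%:Z) e)); first exact: fts_sh.
  exact: hM.
(* From [B[1][-M]] in the coaisle, a shift by -1 gives [B[-M]]. *)
apply: tge1_iso (tge1_sh (k := - 1) _ tB) => //.
apply: isomorphic_trans (sh_add _ _ _) _.
by apply: isomorphic_trans (sh_add _ _ _) _; rewrite (_ : 1 + _ = - M%:Z);
  [exact: isomorphic_refl | lia].
Qed.

(** For the truncation [X -> B] at [M], [gen_ge_tge1] applied to [B[M + 1]] places [B[1]], hence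
    [B], in the coaisle of [t]. The map then vanishes. *)
Lemma tle0_gen_le_of : exists M : nat, forall X, tle0 t X -> gen_le G M X.
Proof.
have [M hM] := gen_ge_tge1; exists M => X lX; have bX := tle0_sub lX.
have [A [B [f [g [h [tr lA gB]]]]]] := gen_truncation coprods M X cG.
have e : extension A X B by exists f, g, h.
have [_ bB] := Tb_trunc e lA gB bX.
have /TminusE [k lB] := bB.1.
apply: (gen_le_of_trunc tr lA gB).
have gB' : tge1 t (sh (sh B (M%:Z + 1)) (- M%:Z)).
  apply: (hM (absz k)).
    by apply: (gen_le_mono _ (gen_le_sh _ lB)); lia.
  by apply: (gen_ge_mono _ (gen_ge_sh gB)); lia.
apply: (t_orthP lX); apply: tge1_iso (tge1_sh (k := - 1) _ gB') => //.
have i : isomorphic (sh (sh B (M%:Z + 1)) (- M%:Z)) (sh B 1) by apply: sh_eqadd; lia.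
exact: isomorphic_trans (sh_isomorphic (- 1) i) (sh_opp B (subrr 1)).
Qed.

Lemma standard_equivalent : Tb G G -> t_equivalent (standard_t_structure cG) t.
Proof.
move=> bG; have [M hM] := tle0_gen_le_of.
have [p hp] := gen_le_tle0_of bG bt.
exists (maxn p M); split=> X.
  move=> h; have bX := t_le_sub fC h; move: h => /t_leE [lX _]; apply: hp => //.
  have {}lX := gen_le_sh (maxn p M)%:Z lX.
  apply: (@gen_le_iso _ _ _ (sh (sh X (- (maxn p M)%:Z)) (maxn p M)%:Z)).
    by apply: sh_opp; rewrite addNr.
  by apply: gen_le_mono lX; lia.
move=> lX; apply/t_leE; split; last exact/Tb_sh/(tle0_sub lX).
by apply: (gen_le_mono _ (gen_le_sh (maxn p M)%:Z (hM X lX))); lia.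
Qed.

End Uniqueness.

Lemma orth_cancel W A E B (f : hom A E) (g : hom E B) h (x : hom W A) :
  triangle f g h -> orth (shift T W) B -> f \oc x = 0 -> x = 0.
Proof.
move=> t o fx.
have [|y yE] := triangle_exactl (x := fmap (shift T) x) (triangle_rot (triangle_rot t)).
  by rewrite compNl -fmap_comp fx raddf0 oppr0.
by apply: (functor_faithful (shift_unshift T)); rewrite yE (o y) comp0r raddf0.
Qed.

(** Uniqueness of truncations, phrased by orthogonality alone so that the two triangles need not
    come from the same t-structure. *)
Lemma extension_orth_unique (A E B A' B' : T) :
  extension A E B -> extension A' E B' ->
  orth A B' -> orth A' B -> orth (sh A 1) B -> orth (sh A' 1) B' -> isomorphic A A'.
Proof.
move=> [f [g [h t]]] [f' [g' [h' t']]] oAB' oA'B sAB sA'B'.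
have [c fE] := triangle_exactl t' (oAB' (g' \oc f)).
have [d f'E] := triangle_exactl t (oA'B (g \oc f')).
exists c, d; split; apply/eqP; rewrite -subr_eq0; apply/eqP.
  by apply: (orth_cancel t sAB); rewrite compBr compA -f'E -fE comp_idr subrr.
by apply: (orth_cancel t' sA'B'); rewrite compBr compA -fE -f'E comp_idr subrr.
Qed.

(** * Consequences of finite strong finitistic dimension *)

Section Finitistic.
Hypothesis wa : weakly_approximable T.
Variables (G : T) (U : T -> Prop) (t : t_structure U) (m : int).
Hypotheses (gG : compact_generator G) (fU : full_triangulated_subcategory U).
Hypotheses (sbU : subcat_le (Tsb G) U) (Ub : subcat_le U (Tb G)) (bt : t_bounded t).
Hypothesis fd : forall X, Tsb G X ->
  (forall i : int, i <= -1 -> orth X (sh G i)) ->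
  exists n : int, n <= m /\ generated G `[n, m] X.

Let UG : U G := sbU (Tsb_base G 0).

(** Since [E] is an extension of [X] by [D[-1]], it lies in the aisle, while [G[-q]] lies in the
    coaisle. So [E[q]] satisfies the finitistic condition, and [E] has degrees at most [m + q]. *)
Lemma finitistic_tle0_gen_le : exists N : int, forall X, tle0 t X -> gen_le G N X.
Proof.
have [p hp] := gen_le_tle0_of UG bt.
have [q gGq] := t_bounded_ge bt UG.
exists ((absz m)%:Z + q%:Z) => X lX; have uX := tle0_sub lX.
(* The depth [- p - 1] puts [D[-1]] in degrees at most [- p], hence in the aisle of [t]. *)
have [E [D [e sE lD]]] := weak_approximation (- p%:Z - 1) wa gG (Ub uX).1.
have uE := sbU sE; have uD := fts_right fU e uE uX.
have lD' : tle0 t (sh D (- 1)).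
  apply: hp; first exact: fts_sh.
  by apply: (gen_le_mono _ (gen_le_sh (- 1) lD)); lia.
have lE := tle0_ext uE (extension_rotV e) lD' lX.
have [|n [_ gE]] := fd (Tsb_sh q%:Z sE).
  move=> i im; apply/(orth_shift E G (erefl (i - q%:Z))).
  have iq : i - q%:Z + q%:Z <= 0 by lia.
  apply: (t_orthP lE); apply: tge1_iso (tge1_sh iq gGq).
  by apply: sh_eqadd; lia.
have {}lE : gen_le G (m + q%:Z) E.
  apply: (@gen_le_iso _ _ _ (sh (sh E q%:Z) (- q%:Z))).
    by apply: sh_opp; rewrite subrr.
  by apply: gen_sh gE => i; rewrite !in_itv /=; lia.
by apply: (gen_le_ext e); [apply: gen_le_mono lE | apply: gen_le_mono lD]; lia.
Qed.

(* [X] is the cone of [D[-1] -> E] with [E] in [Tsb G] and [D] very negative.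
   Orthogonality identifies [D[-1]] with a [t]-truncation of [E], so it is in [U]. *)
Lemma finitistic_Tb : subcat_le (Tb G) U.
Proof.
move=> X [mX /TplusE [c gX]].
have [N hN] := finitistic_tle0_gen_le.
have [p hp] := tge1_gen_ge UG bt.
(* Truncating [E] at [j] puts [A] in degrees at most [N + j = c - 1], orthogonal to [X]. The depth
   [k] makes [D[-1]] orthogonal to [B], and [D] orthogonal to [X]. *)
pose j := c - N - 1; pose k := - (absz j)%:Z - p%:Z - (absz c)%:Z - 2.
have [E [D [e sE lD]]] := weak_approximation k wa gG mX.
have [A [B [eE /[dup] /tle0_sub uA lA gB sAB]]] := t_trunc_sh fU t j (sbU sE).
have {}lA : gen_le G (N + j) A.
  apply: (@gen_le_iso _ _ _ (sh (sh A j) (- j))); first by apply: sh_opp; rewrite subrr.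
  by have := gen_le_sh (- j) (hN _ lA); rewrite opprK.
have {}gB : gen_ge G (1 - p%:Z + j) B.
  apply: (@gen_ge_iso _ _ _ (sh (sh B j) (- j))); first by apply: sh_opp; rewrite subrr.
  by have := gen_ge_sh (k := - j) (hp _ gB); rewrite opprK.
have lD' := gen_le_sh (- 1) lD.
have /isomorphic_sym i : isomorphic A (sh D (- 1)).
  apply: (extension_orth_unique eE (extension_rotV e)) => //.
  - by apply: (gen_le_ge_orth _ lA gX); rewrite /j; lia.
  - by apply: (gen_le_ge_orth _ lD' gB); rewrite /k; lia.
  - by apply: (gen_le_ge_orth _ (gen_le_sh 1 lD') gX); rewrite /k; lia.
apply: (fts_right fU (extension_rotV e) _ (sbU sE)).
by apply: (fts_iso fU (isomorphic_sym i)); exact: fts_shE uA.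
Qed.

End Finitistic.

Lemma Tb_generator G K : compact_generator G -> compact_generator K ->
  subcat_le (Tb K) (Tb G).
Proof.
by move=> gG gK X [mX pX]; split; [exact: Tminus_generator mX | exact: Tplus_generator pX].
Qed.

End BoundedTStructures.

Theorem theorem1p4 (T : triangulated) (T_coproducts : has_small_coproducts T)
  (T_wa : weakly_approximable T)
  (T_bcg : exists G0 : T, compact_generator G0 /\ bounded_object G0)
  (G : T) (G_gen : compact_generator G) :
  (exists t : t_structure (Tb G),
     t_bounded t /\
     forall t' : t_structure (Tb G), t_bounded t' -> t_equivalent t t')
  /\
  (finite_strong_finitistic_dimension T ->
     (forall U : T -> Prop,
        full_triangulated_subcategory U ->
        subcat_le (Tsb G) U ->
        subcat_le U (Tb G) ->
        (exists X : T, Tb G X /\ ~ U X) ->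
        ~ admits_bounded_t_structure U)
     /\
     (admits_bounded_t_structure (Tsb G) <-> subcat_eq (Tsb G) (Tb G))).
Proof.
have [G0 [G0_gen G0_bounded]] := T_bcg.
have sb_b := Tsb_Tb T_coproducts G_gen G0_gen G0_bounded.
have cG := compact_fincompact G_gen.1.
have bt := standard_bounded T_coproducts cG.
split.
  exists (standard_t_structure T_coproducts cG); split=> // t' bt'.
  exact/(standard_equivalent T_coproducts G_gen bt')/sb_b/(Tsb_base G 0).
move=> [K [K_gen [m fd]]].
have noU (U : T -> Prop) : full_triangulated_subcategory U ->
    subcat_le (Tsb G) U -> subcat_le U (Tb G) ->
    (exists X : T, Tb G X /\ ~ U X) -> ~ admits_bounded_t_structure U.
  move=> fU sU Ub [X [bX nX]] [t bt']; apply: nX.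
  (* The finitistic bound is given for [K], so the inclusions for [G] are transported to [K]. *)
  apply: (finitistic_Tb T_coproducts T_wa K_gen fU _ _ bt' fd).
  - by move=> Y /(Tsb_generator T_coproducts G_gen K_gen)/sU.
  - by move=> Y /Ub/(Tb_generator T_coproducts K_gen G_gen).
  - exact: (Tb_generator T_coproducts K_gen G_gen bX).
split=> //; split=> [adm X|e].
  split; first exact: sb_b.
  move=> bX; apply: contrapT => nX.
  by apply: (noU (Tsb G) (Tsb_fts G) _ sb_b _ adm) => //; exists X.
(* The type of a t-structure depends on the predicate, so the equivalence is turned into an
   equality. *)
have -> : Tsb G = Tb G by apply/funext => X; exact/propext/e.
by exists (standard_t_structure T_coproducts cG).
Qed.
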